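(* A monoidal double category $(\mathbb D,\otimes,I,\alpha,\lambda,\rho)$ in which $\alpha,\lambda,\rho$ are liftable vertical transformations yields a horizontally monoidal double category $(\mathbb D,\otimes,I,\hat\alpha,\hat\lambda,\hat\rho)$, where $\hat\alpha,\hat\lambda,\hat\rho$ are the companion-lifts of $\alpha,\lambda,\rho$.
   Context: Double categories are strict: objects, 1h-cells (horizontal), 1v-cells (vertical), squares (2-cells). $[a|b]$: horizontal composition ($a$ left); $a/b$: vertical composition ($a$ on top), also for 1v-cells and transformations. A 2-cell is horizontally globular if its vertical sides are identities; $\mathcal H(\mathbb D)$ is the 2-category of objects, 1h-cells and horizontally globular 2-cells. Pseudodouble functors preserve vertical structure strictly and horizontal composition up to coherent natural invertible compositors and unitors. A horizontal pseudonatural transformation $\alpha:F\Rightarrow G$ has 1h-components $\alpha(A)$; squares $\alpha^u$ (top $\alpha(A)$, bottom $\alpha(\tilde A)$, left $F(u)$, right $G(u)$), functorial in $u$; invertible horizontally globular 2-cells $\delta_{\alpha,f}:\alpha(B)F(f)\Rightarrow G(f)\alpha(A)$ compatible with compositors and unitors; and $[F(a)|\alpha^v]/\delta_{\alpha,g}=\delta_{\alpha,f}/[\alpha^u|G(a)]$ for each 2-cell $a$ (top $f$, bottom $g$, left $u$, right $v$). It is a horizontal equivalence if all $\alpha(A)$ are equivalences in $\mathcal H$. A horizontal modification $\alpha\Rrightarrow\beta$ is a family of horizontally globular 2-cells $\alpha(A)\Rightarrow\beta(A)$ compatible with $\delta_{\alpha,f},\delta_{\beta,f}$ and $\alpha^u,\beta^u$.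 A vertical strict transformation $\alpha:F\Rightarrow G$ has 1v-components natural in 1v-cells and squares $\alpha_f$ (top $F(f)$, bottom $G(f)$, left $\alpha(A)$, right $\alpha(B)$) compatible with compositors, unitors and 2-cells; it is invertible if all $\alpha_f$ are vertically invertible. Monoidal double category: pseudodouble functors $\otimes:\mathbb D\times\mathbb D\to\mathbb D$, $I:*\to\mathbb D$ and invertible vertical strict transformations $\alpha:(A\otimes B)\otimes C\to A\otimes(B\otimes C)$, $\lambda:I\otimes A\to A$, $\rho:A\otimes I\to A$ satisfying strictly the pentagon and the three unit triangles. Companion of a 1v-cell $u:A\to B$: a 1h-cell $\hat u:A\to B$ with 2-cells $\varepsilon_u$ (top $\hat u$, left $u$, other sides identities), $\eta_u$ (bottom $\hat u$, right $u$, other sides identities), $[\eta_u|\varepsilon_u]=\mathrm{Id}_{\hat u}$, $\eta_u/\varepsilon_u=\mathrm{Id}^u$. A vertical transformation is liftable if all its 1v-components have companions. The companion-lift $\hat\alpha$ of an invertible liftable vertical strict $\alpha:F\Rightarrow G$ is the horizontal equivalence with components the companions $\hat\alpha(A)$, $\delta_{\hat\alpha,f}=[\eta_{\alpha(A)}|\alpha_f|\varepsilon_{\alpha(B)}]$, $\hat\alpha^u=[\mathrm{Id}^{F(u)}/\eta_{\alpha(\tilde A)}|\varepsilon_{\alpha(A)}/\mathrm{Id}^{G(u)}]$. Horizontally monoidal double category: pseudodouble functors $\otimes,I$ with horizontal equivalences $\alpha,\lambda,\rho$ (associativity, left and right unit) and (invertible) horizontal modifications $p$ (pentagon), $m$ (middle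 unit triangle relating $\alpha_{A,I,B}$, $A\otimes\lambda_B$, $\rho_A\otimes B$), $l$ (relating $\alpha_{I,A,B}$, $\lambda_{A\otimes B}$, $\lambda_A\otimes B$), $r$ (relating $\alpha_{A,B,I}$, $A\otimes\rho_B$, $\rho_{A\otimes B}$), whose 2-cell components satisfy the three axioms (TA1)–(TA3) of a one-object tricategory (nonabelian 4-cocycle condition, left and right normalization) of Gordon–Power–Street, read as equations of pasted horizontally globular 2-cells.
   Formalization: Added hypothesis: the inverses of the 1v-components of α, λ, ρ also have companions; with liftability of α, λ, ρ alone the companion-lifts need not be horizontal equivalences, and the added condition is exactly what makes their components equivalences. *)

(* Defs.v *)
Set Implicit Arguments.
Unset Strict Implicit.
Unset Printing Implicit Defensive.

(** * Strict double categories

    1h-cells, 1v-cells and squares each form one type, with boundary maps, so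
    that strict associativity and unitality are plain equalities without
    transports.  The composition functions are total, but only their values on
    composable pairs are constrained by [is_dbl] and only such composites occur
    in the definitions below; the other values are junk.

    All composites are in diagrammatic order: [hcomp f g] is "first [f], then
    [g]" (written [gf] in applicative order), [hcs a b] is [[a|b]] with [a] on
    the left, and [vcs a b] is [a/b] with [a] on top. *)

Record dbl : Type := Dbl {
  Ob : Type;
  Hc : Type;
  Vc : Type;
  Sq : Type;
  hsrc : Hc -> Ob;
  htgt : Hc -> Ob;
  vsrc : Vc -> Ob;
  vtgt : Vc -> Ob;
  top : Sq -> Hc;
  bot : Sq -> Hc;
  lft : Sq -> Vc;
  rgt : Sq -> Vc;
  hid : Ob -> Hc;
  hcomp : Hc -> Hc -> Hc;
  vid : Ob -> Vc;
  vcomp : Vc -> Vc -> Vc;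
  sqH : Hc -> Sq;          (* Id_f, the vertical identity on a 1h-cell *)
  sqV : Vc -> Sq;          (* Id^u, the horizontal identity on a 1v-cell *)
  hcs : Sq -> Sq -> Sq;
  vcs : Sq -> Sq -> Sq
}.

Arguments hid {d} _.
Arguments vid {d} _.

Declare Scope dbl_scope.
Delimit Scope dbl_scope with dbl.
Local Open Scope dbl_scope.

Notation "f ⋅ g" := (hcomp f g) (at level 40, left associativity) : dbl_scope.
Notation "a ∥ b" := (hcs a b) (at level 45, left associativity) : dbl_scope.
Notation "a ⫽ b" := (vcs a b) (at level 50, left associativity) : dbl_scope.

Definition isH (D : dbl) (f : Hc D) (A B : Ob D) : Prop :=
  hsrc f = A /\ htgt f = B.

Definition isV (D : dbl) (u : Vc D) (A B : Ob D) : Prop :=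
  vsrc u = A /\ vtgt u = B.

Definition isSq (D : dbl) (a : Sq D) (f g : Hc D) (u v : Vc D) : Prop :=
  top a = f /\ bot a = g /\ lft a = u /\ rgt a = v.

Record is_dbl (D : dbl) : Prop := {
  sq_nw : forall a : Sq D, hsrc (top a) = vsrc (lft a);
  sq_ne : forall a : Sq D, htgt (top a) = vsrc (rgt a);
  sq_sw : forall a : Sq D, hsrc (bot a) = vtgt (lft a);
  sq_se : forall a : Sq D, htgt (bot a) = vtgt (rgt a);

  hid_bd : forall A : Ob D, isH (hid A) A A;
  hcomp_bd : forall f g : Hc D, htgt f = hsrc g ->
    isH (f ⋅ g) (hsrc f) (htgt g);
  hcomp_1l : forall f : Hc D, hid (hsrc f) ⋅ f = f;
  hcomp_1r : forall f : Hc D, f ⋅ hid (htgt f) = f;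
  hcomp_assoc : forall f g h : Hc D, htgt f = hsrc g -> htgt g = hsrc h ->
    (f ⋅ g) ⋅ h = f ⋅ (g ⋅ h);

  vid_bd : forall A : Ob D, isV (vid A) A A;
  vcomp_bd : forall u v : Vc D, vtgt u = vsrc v ->
    isV (vcomp u v) (vsrc u) (vtgt v);
  vcomp_1l : forall u : Vc D, vcomp (vid (vsrc u)) u = u;
  vcomp_1r : forall u : Vc D, vcomp u (vid (vtgt u)) = u;
  vcomp_assoc : forall u v w : Vc D, vtgt u = vsrc v -> vtgt v = vsrc w ->
    vcomp (vcomp u v) w = vcomp u (vcomp v w);

  sqH_bd : forall f : Hc D, isSq (sqH f) f f (vid (hsrc f)) (vid (htgt f));
  sqV_bd : forall u : Vc D, isSq (sqV u) (hid (vsrc u)) (hid (vtgt u)) u u;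
  hcs_bd : forall a b : Sq D, rgt a = lft b ->
    isSq (a ∥ b) (top a ⋅ top b) (bot a ⋅ bot b) (lft a) (rgt b);
  vcs_bd : forall a b : Sq D, bot a = top b ->
    isSq (a ⫽ b) (top a) (bot b) (vcomp (lft a) (lft b)) (vcomp (rgt a) (rgt b));

  hcs_1l : forall a : Sq D, sqV (lft a) ∥ a = a;
  hcs_1r : forall a : Sq D, a ∥ sqV (rgt a) = a;
  hcs_assoc : forall a b c : Sq D, rgt a = lft b -> rgt b = lft c ->
    (a ∥ b) ∥ c = a ∥ (b ∥ c);
  vcs_1l : forall a : Sq D, sqH (top a) ⫽ a = a;
  vcs_1r : forall a : Sq D, a ⫽ sqH (bot a) = a;
  vcs_assoc : forall a b c : Sq D, bot a = top b -> bot b = top c ->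
    (a ⫽ b) ⫽ c = a ⫽ (b ⫽ c);

  interchange : forall a b c d : Sq D,
    rgt a = lft b -> rgt c = lft d -> bot a = top c -> bot b = top d ->
    (a ∥ b) ⫽ (c ∥ d) = (a ⫽ c) ∥ (b ⫽ d);
  sqH_hid : forall A : Ob D, sqH (hid A) = sqV (vid A);
  sqH_hcomp : forall f g : Hc D, htgt f = hsrc g ->
    sqH (f ⋅ g) = sqH f ∥ sqH g;
  sqV_vcomp : forall u v : Vc D, vtgt u = vsrc v ->
    sqV (vcomp u v) = sqV u ⫽ sqV v
}.

(** [a] is a 2-cell [f => g] of the horizontal 2-category. *)
Definition glob (D : dbl) (a : Sq D) (f g : Hc D) : Prop :=
  isSq a f g (vid (hsrc f)) (vid (htgt f)).

Definition vinverse (D : dbl) (a b : Sq D) : Prop :=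
  bot a = top b /\ bot b = top a /\
  a ⫽ b = sqH (top a) /\ b ⫽ a = sqH (bot a).

Definition vinvertible (D : dbl) (a : Sq D) : Prop := exists b, vinverse a b.

Definition hequiv (D : dbl) (f : Hc D) : Prop :=
  exists g : Hc D, isH g (htgt f) (hsrc f) /\
    (exists a, glob a (f ⋅ g) (hid (hsrc f)) /\ vinvertible a) /\
    (exists b, glob b (g ⋅ f) (hid (htgt f)) /\ vinvertible b).

Definition dprod (D E : dbl) : dbl := {|
  Ob := Ob D * Ob E;
  Hc := Hc D * Hc E;
  Vc := Vc D * Vc E;
  Sq := Sq D * Sq E;
  hsrc := fun f => (hsrc (fst f), hsrc (snd f));
  htgt := fun f => (htgt (fst f), htgt (snd f));
  vsrc := fun u => (vsrc (fst u), vsrc (snd u));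
  vtgt := fun u => (vtgt (fst u), vtgt (snd u));
  top := fun a => (top (fst a), top (snd a));
  bot := fun a => (bot (fst a), bot (snd a));
  lft := fun a => (lft (fst a), lft (snd a));
  rgt := fun a => (rgt (fst a), rgt (snd a));
  hid := fun A => (hid (fst A), hid (snd A));
  hcomp := fun f g => (fst f ⋅ fst g, snd f ⋅ snd g);
  vid := fun A => (vid (fst A), vid (snd A));
  vcomp := fun u v => (vcomp (fst u) (fst v), vcomp (snd u) (snd v));
  sqH := fun f => (sqH (fst f), sqH (snd f));
  sqV := fun u => (sqV (fst u), sqV (snd u));
  hcs := fun a b => (fst a ∥ fst b, snd a ∥ snd b);
  vcs := fun a b => (fst a ⫽ fst b, snd a ⫽ snd b)
|}.

Definition dunit : dbl := {|
  Ob := unit; Hc := unit; Vc := unit; Sq := unit;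
  hsrc := fun _ => tt; htgt := fun _ => tt;
  vsrc := fun _ => tt; vtgt := fun _ => tt;
  top := fun _ => tt; bot := fun _ => tt;
  lft := fun _ => tt; rgt := fun _ => tt;
  hid := fun _ => tt; hcomp := fun _ _ => tt;
  vid := fun _ => tt; vcomp := fun _ _ => tt;
  sqH := fun _ => tt; sqV := fun _ => tt;
  hcs := fun _ _ => tt; vcs := fun _ _ => tt
|}.

Notation "D × E" := (dprod D E) (at level 40, left associativity) : dbl_scope.

(** * Pseudodouble functors

    Data and axioms are separated, so that composites and products of the data
    can be formed without proof obligations.  Inverse compositors and unitors
    belong to the data; they are determined by the axioms. *)

Record pdf (D E : dbl) : Type := Pdf {
  fO : Ob D -> Ob E;
  fH : Hc D -> Hc E;
  fV : Vc D -> Vc E;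
  fS : Sq D -> Sq E;
  fc : Hc D -> Hc D -> Sq E;     (* compositor F(f)⋅F(g) => F(f⋅g) *)
  fci : Hc D -> Hc D -> Sq E;
  fu : Ob D -> Sq E;             (* unitor id_F(A) => F(id_A) *)
  fui : Ob D -> Sq E
}.

Record is_pdf (D E : dbl) (F : pdf D E) : Prop := {
  fH_bd : forall f, isH (fH F f) (fO F (hsrc f)) (fO F (htgt f));
  fV_bd : forall u, isV (fV F u) (fO F (vsrc u)) (fO F (vtgt u));
  fS_bd : forall a, isSq (fS F a) (fH F (top a)) (fH F (bot a))
                                  (fV F (lft a)) (fV F (rgt a));
  fV_vid : forall A, fV F (vid A) = vid (fO F A);
  fV_vcomp : forall u v, vtgt u = vsrc v ->
    fV F (vcomp u v) = vcomp (fV F u) (fV F v);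
  fS_sqH : forall f, fS F (sqH f) = sqH (fH F f);
  fS_vcs : forall a b, bot a = top b -> fS F (a ⫽ b) = fS F a ⫽ fS F b;
  fc_bd : forall f g, htgt f = hsrc g ->
    glob (fc F f g) (fH F f ⋅ fH F g) (fH F (f ⋅ g));
  fc_inv : forall f g, htgt f = hsrc g -> vinverse (fc F f g) (fci F f g);
  fc_nat : forall a b, rgt a = lft b ->
    (fS F a ∥ fS F b) ⫽ fc F (bot a) (bot b) =
    fc F (top a) (top b) ⫽ fS F (a ∥ b);
  fu_bd : forall A, glob (fu F A) (hid (fO F A)) (fH F (hid A));
  fu_inv : forall A, vinverse (fu F A) (fui F A);
  fu_nat : forall u,
    sqV (fV F u) ⫽ fu F (vtgt u) = fu F (vsrc u) ⫽ fS F (sqV u);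
  fc_assoc : forall f g h, htgt f = hsrc g -> htgt g = hsrc h ->
    (fc F f g ∥ sqH (fH F h)) ⫽ fc F (f ⋅ g) h =
    (sqH (fH F f) ∥ fc F g h) ⫽ fc F f (g ⋅ h);
  fc_unit_l : forall f,
    (fu F (hsrc f) ∥ sqH (fH F f)) ⫽ fc F (hid (hsrc f)) f = sqH (fH F f);
  fc_unit_r : forall f,
    (sqH (fH F f) ∥ fu F (htgt f)) ⫽ fc F f (hid (htgt f)) = sqH (fH F f)
}.

Definition fid (D : dbl) : pdf D D := {|
  fO := fun A => A; fH := fun f => f; fV := fun u => u; fS := fun a => a;
  fc := fun f g => sqH (f ⋅ g); fci := fun f g => sqH (f ⋅ g);
  fu := fun A => sqH (hid A); fui := fun A => sqH (hid A)
|}.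

(** [fcomp G F] is [F] followed by [G]. *)
Definition fcomp (C D E : dbl) (G : pdf D E) (F : pdf C D) : pdf C E := {|
  fO := fun A => fO G (fO F A);
  fH := fun f => fH G (fH F f);
  fV := fun u => fV G (fV F u);
  fS := fun a => fS G (fS F a);
  fc := fun f g => fc G (fH F f) (fH F g) ⫽ fS G (fc F f g);
  fci := fun f g => fS G (fci F f g) ⫽ fci G (fH F f) (fH F g);
  fu := fun A => fu G (fO F A) ⫽ fS G (fu F A);
  fui := fun A => fS G (fui F A) ⫽ fui G (fO F A)
|}.

Definition fprod (C D C' D' : dbl) (F : pdf C D) (G : pdf C' D')
  : pdf (C × C') (D × D') := {|
  fO := fun A : Ob (C × C') => (fO F (fst A), fO G (snd A)) : Ob (D × D');
  fH := fun f : Hc (C × C') => (fH F (fst f), fH G (snd f)) : Hc (D × D');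
  fV := fun u : Vc (C × C') => (fV F (fst u), fV G (snd u)) : Vc (D × D');
  fS := fun a : Sq (C × C') => (fS F (fst a), fS G (snd a)) : Sq (D × D');
  fc := fun f g : Hc (C × C') => (fc F (fst f) (fst g), fc G (snd f) (snd g)) : Sq (D × D');
  fci := fun f g : Hc (C × C') => (fci F (fst f) (fst g), fci G (snd f) (snd g)) : Sq (D × D');
  fu := fun A : Ob (C × C') => (fu F (fst A), fu G (snd A)) : Sq (D × D');
  fui := fun A : Ob (C × C') => (fui F (fst A), fui G (snd A)) : Sq (D × D')
|}.

(** Strict functors, with identity compositors and unitors. *)
Definition strict (D E : dbl) (o : Ob D -> Ob E) (h : Hc D -> Hc E)
    (v : Vc D -> Vc E) (s : Sq D -> Sq E) : pdf D E := {|
  fO := o; fH := h; fV := v; fS := s;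
  fc := fun f g => sqH (h (f ⋅ g)); fci := fun f g => sqH (h (f ⋅ g));
  fu := fun A => sqH (h (hid A)); fui := fun A => sqH (h (hid A))
|}.

Definition reassoc (X Y Z : Type) (t : X * Y * Z) : X * (Y * Z) :=
  (fst (fst t), (snd (fst t), snd t)).

Definition fassoc (C D E : dbl) : pdf (C × D × E) (C × (D × E)) :=
  @strict (C × D × E) (C × (D × E))
    (@reassoc _ _ _) (@reassoc _ _ _) (@reassoc _ _ _) (@reassoc _ _ _).

Definition funitl (D : dbl) : pdf D (dunit × D) :=
  @strict D (dunit × D) (pair tt) (pair tt) (pair tt) (pair tt).

Definition funitr (D : dbl) : pdf D (D × dunit) :=
  @strict D (D × dunit) (fun x => (x, tt)) (fun x => (x, tt))
                        (fun x => (x, tt)) (fun x => (x, tt)).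

(** * Vertical strict transformations *)

Record vtr (D E : dbl) : Type := Vtr {
  vO : Ob D -> Vc E;
  vH : Hc D -> Sq E
}.

Record is_vtr (D E : dbl) (F G : pdf D E) (t : vtr D E) : Prop := {
  vO_bd : forall A, isV (vO t A) (fO F A) (fO G A);
  vH_bd : forall f, isSq (vH t f) (fH F f) (fH G f)
                                  (vO t (hsrc f)) (vO t (htgt f));
  vO_nat : forall u,
    vcomp (fV F u) (vO t (vtgt u)) = vcomp (vO t (vsrc u)) (fV G u);
  vH_nat : forall a, fS F a ⫽ vH t (bot a) = vH t (top a) ⫽ fS G a;
  vH_fc : forall f g, htgt f = hsrc g ->
    (vH t f ∥ vH t g) ⫽ fc G f g = fc F f g ⫽ vH t (f ⋅ g);
  vH_fu : forall A, sqV (vO t A) ⫽ fu G A = fu F A ⫽ vH t (hid A)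
}.

Definition vtr_invertible (D E : dbl) (t : vtr D E) : Prop :=
  forall f, vinvertible (vH t f).

Definition vtr_eq (D E : dbl) (s t : vtr D E) : Prop :=
  (forall A, vO s A = vO t A) /\ (forall f, vH s f = vH t f).

Definition vtr_id (D E : dbl) (F : pdf D E) : vtr D E := {|
  vO := fun A => vid (fO F A);
  vH := fun f => sqH (fH F f)
|}.

Definition vtr_comp (D E : dbl) (s t : vtr D E) : vtr D E := {|
  vO := fun A => vcomp (vO s A) (vO t A);
  vH := fun f => vH s f ⫽ vH t f
|}.

Definition vtr_prod (C D C' D' : dbl) (s : vtr C D) (t : vtr C' D')
  : vtr (C × C') (D × D') := {|
  vO := fun A : Ob (C × C') => (vO s (fst A), vO t (snd A)) : Vc (D × D');
  vH := fun f : Hc (C × C') => (vH s (fst f), vH t (snd f)) : Sq (D × D')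
|}.

(** [t * K : F K => G K] and [L * t : L F => L G]. *)
Definition vtr_pre (C D E : dbl) (K : pdf C D) (t : vtr D E) : vtr C E := {|
  vO := fun A => vO t (fO K A);
  vH := fun f => vH t (fH K f)
|}.

Definition vtr_post (C D E : dbl) (L : pdf D E) (t : vtr C D) : vtr C E := {|
  vO := fun A => fV L (vO t A);
  vH := fun f => fS L (vH t f)
|}.

(** * Horizontal pseudonatural transformations *)

Record htr (D E : dbl) : Type := Htr {
  hO : Ob D -> Hc E;
  hV : Vc D -> Sq E;             (* α^u *)
  hδ : Hc D -> Sq E              (* δ_{α,f} : F(f)⋅α(B) => α(A)⋅G(f) *)
}.

Record is_htr (D E : dbl) (F G : pdf D E) (t : htr D E) : Prop := {
  hO_bd : forall A, isH (hO t A) (fO F A) (fO G A);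
  hV_bd : forall u, isSq (hV t u) (hO t (vsrc u)) (hO t (vtgt u))
                                  (fV F u) (fV G u);
  hV_vid : forall A, hV t (vid A) = sqH (hO t A);
  hV_vcomp : forall u v, vtgt u = vsrc v ->
    hV t (vcomp u v) = hV t u ⫽ hV t v;
  hδ_bd : forall f, glob (hδ t f) (fH F f ⋅ hO t (htgt f))
                                  (hO t (hsrc f) ⋅ fH G f);
  hδ_inv : forall f, vinvertible (hδ t f);
  hδ_fc : forall f g, htgt f = hsrc g ->
    (fc F f g ∥ sqH (hO t (htgt g))) ⫽ hδ t (f ⋅ g) =
    (sqH (fH F f) ∥ hδ t g) ⫽ (hδ t f ∥ sqH (fH G g))
      ⫽ (sqH (hO t (hsrc f)) ∥ fc G f g);
  hδ_fu : forall A,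
    (fu F A ∥ sqH (hO t A)) ⫽ hδ t (hid A) = sqH (hO t A) ∥ fu G A;
  hδ_nat : forall a,
    (fS F a ∥ hV t (rgt a)) ⫽ hδ t (bot a) =
    hδ t (top a) ⫽ (hV t (lft a) ∥ fS G a)
}.

Definition is_horizontal_equivalence (D E : dbl) (F G : pdf D E) (t : htr D E)
  : Prop :=
  is_htr F G t /\ forall A, hequiv (hO t A).

Definition htr_id (D E : dbl) (F : pdf D E) : htr D E := {|
  hO := fun A => hid (fO F A);
  hV := fun u => sqV (fV F u);
  hδ := fun f => sqH (fH F f)
|}.

Definition htr_comp (D E : dbl) (s t : htr D E) : htr D E := {|
  hO := fun A => hO s A ⋅ hO t A;
  hV := fun u => hV s u ∥ hV t u;
  hδ := fun f => (hδ s f ∥ sqH (hO t (htgt f))) ⫽ (sqH (hO s (hsrc f)) ∥ hδ t f)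
|}.

Definition htr_prod (C D C' D' : dbl) (s : htr C D) (t : htr C' D')
  : htr (C × C') (D × D') := {|
  hO := fun A : Ob (C × C') => (hO s (fst A), hO t (snd A)) : Hc (D × D');
  hV := fun u : Vc (C × C') => (hV s (fst u), hV t (snd u)) : Sq (D × D');
  hδ := fun f : Hc (C × C') => (hδ s (fst f), hδ t (snd f)) : Sq (D × D')
|}.

(** [t * K : F K => G K] and, for [t : F => G], [L * t : L F => L G]. *)
Definition htr_pre (C D E : dbl) (K : pdf C D) (t : htr D E) : htr C E := {|
  hO := fun A => hO t (fO K A);
  hV := fun u => hV t (fV K u);
  hδ := fun f => hδ t (fH K f)
|}.

Definition htr_post (C D E : dbl) (L : pdf D E) (F G : pdf C D) (t : htr C D)
  : htr C E := {|
  hO := fun A => fH L (hO t A);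
  hV := fun u => fS L (hV t u);
  hδ := fun f => fc L (fH F f) (hO t (htgt f)) ⫽ fS L (hδ t f)
                   ⫽ fci L (hO t (hsrc f)) (fH G f)
|}.

(** Invertible horizontal modifications [s => t] between [s, t : F => G]. *)
Record is_inv_modification (D E : dbl) (F G : pdf D E) (s t : htr D E)
    (m : Ob D -> Sq E) : Prop := {
  mod_bd : forall A, glob (m A) (hO s A) (hO t A);
  mod_inv : forall A, vinvertible (m A);
  mod_δ : forall f,
    (sqH (fH F f) ∥ m (htgt f)) ⫽ hδ t f = hδ s f ⫽ (m (hsrc f) ∥ sqH (fH G f));
  mod_V : forall u, hV s u ⫽ m (vtgt u) = m (vsrc u) ⫽ hV t u
}.

(** * Companions and companion-lifts *)

Record is_companion (D : dbl) (u : Vc D) (c : Hc D) (ε η : Sq D) : Prop := {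
  comp_bd : isH c (vsrc u) (vtgt u);
  comp_ε : isSq ε c (hid (vtgt u)) u (vid (vtgt u));
  comp_η : isSq η (hid (vsrc u)) c (vid (vsrc u)) u;
  comp_h : η ∥ ε = sqH c;
  comp_v : η ⫽ ε = sqV u
}.

Definition liftable (D E : dbl) (t : vtr D E) : Prop :=
  forall A, exists c ε η, is_companion (vO t A) c ε η.

(** Liftability of the inverse of an invertible transformation.  The companion
    of an invertible 1v-cell [u] is an equivalence exactly when [u^-1] has a
    companion as well, which does not follow from [u] having one. *)
Definition inverse_liftable (D E : dbl) (t : vtr D E) : Prop :=
  forall A v, isV v (vtgt (vO t A)) (vsrc (vO t A)) ->
    vcomp (vO t A) v = vid (vsrc (vO t A)) ->
    vcomp v (vO t A) = vid (vtgt (vO t A)) ->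
    exists c ε η, is_companion v c ε η.

Record companions (D E : dbl) : Type := Companions {
  cO : Ob D -> Hc E;
  cε : Ob D -> Sq E;
  cη : Ob D -> Sq E
}.

Definition is_companions (D E : dbl) (t : vtr D E) (c : companions D E) : Prop :=
  forall A, is_companion (vO t A) (cO c A) (cε c A) (cη c A).

Definition companion_lift (D E : dbl) (F G : pdf D E) (t : vtr D E)
    (c : companions D E) : htr D E := {|
  hO := cO c;
  hV := fun u => (sqV (fV F u) ⫽ cη c (vtgt u)) ∥ (cε c (vsrc u) ⫽ sqV (fV G u));
  hδ := fun f => cη c (hsrc f) ∥ vH t f ∥ cε c (htgt f)
|}.

(** * Functors entering the associativity and unit constraints *)

Section TensorFunctors.
Variables (D : dbl) (T : pdf (D × D) D) (I : pdf dunit D).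

Definition assocL : pdf (D × D × D) D :=            (* (A⊗B)⊗C *)
  fcomp T (fprod T (fid D)).
Definition assocR : pdf (D × D × D) D :=            (* A⊗(B⊗C) *)
  fcomp T (fcomp (fprod (fid D) T) (fassoc D D D)).
Definition unitL : pdf D D :=                       (* I⊗A *)
  fcomp T (fcomp (fprod I (fid D)) (funitl D)).
Definition unitR : pdf D D :=                       (* A⊗I *)
  fcomp T (fcomp (fprod (fid D) I) (funitr D)).

(** Reindexings of quadruples, [(((A,B),C),D)] being sent to the expression
    in the comment, and of pairs [(A,B)]. *)
Definition K_A_BC_D : pdf (D × D × D × D) (D × D × D) :=    (* ((A,B⊗C),D) *)
  fprod (fcomp (fprod (fid D) T) (fassoc D D D)) (fid D).
Definition K_AB_C_D : pdf (D × D × D × D) (D × D × D) :=    (* ((A⊗B,C),D) *)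
  fprod (fprod T (fid D)) (fid D).
Definition K_A_B_CD : pdf (D × D × D × D) (D × D × D) :=    (* ((A,B),C⊗D) *)
  fcomp (fprod (fid (D × D)) T) (fassoc (D × D) D D).
Definition K_A'BCD : pdf (D × D × D × D) (D × (D × D × D)) := (* (A,((B,C),D)) *)
  fcomp (fassoc D (D × D) D) (fprod (fassoc D D D) (fid D)).

Definition K_A_I_B : pdf (D × D) (D × D × D) :=     (* ((A,I),B) *)
  fprod (fcomp (fprod (fid D) I) (funitr D)) (fid D).
Definition K_I_A_B : pdf (D × D) (D × D × D) :=     (* ((I,A),B) *)
  fprod (fcomp (fprod I (fid D)) (funitl D)) (fid D).
Definition K_A_B_I : pdf (D × D) (D × D × D) :=     (* ((A,B),I) *)
  fcomp (fprod (fid (D × D)) I) (funitr (D × D)).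

Definition quadL : pdf (D × D × D × D) D :=         (* ((A⊗B)⊗C)⊗D *)
  fcomp T (fprod assocL (fid D)).
Definition quadR : pdf (D × D × D × D) D :=         (* A⊗(B⊗(C⊗D)) *)
  fcomp (fcomp T (fprod (fid D) assocR)) K_A'BCD.
Definition pairRI : pdf (D × D) D :=                (* (A⊗I)⊗B *)
  fcomp T (fprod unitR (fid D)).
Definition pairLI : pdf (D × D) D :=                (* (I⊗A)⊗B *)
  fcomp T (fprod unitL (fid D)).
Definition pairIR : pdf (D × D) D :=                (* (A⊗B)⊗I *)
  fcomp unitR T.

End TensorFunctors.

(** * Monoidal double categories *)

Record is_monoidal_double (D : dbl) (T : pdf (D × D) D) (I : pdf dunit D)
    (α : vtr (D × D × D) D) (λ ρ : vtr D D) : Prop := {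
  md_dbl : is_dbl D;
  md_T : is_pdf T;
  md_I : is_pdf I;
  md_α : is_vtr (assocL T) (assocR T) α;
  md_α_inv : vtr_invertible α;
  md_λ : is_vtr (unitL T I) (fid D) λ;
  md_λ_inv : vtr_invertible λ;
  md_ρ : is_vtr (unitR T I) (fid D) ρ;
  md_ρ_inv : vtr_invertible ρ;
  md_pentagon :
    vtr_eq
      (vtr_comp (vtr_post T (vtr_prod α (vtr_id (fid D))))
        (vtr_comp (vtr_pre (K_A_BC_D T) α)
          (vtr_pre (K_A'BCD D) (vtr_post T (vtr_prod (vtr_id (fid D)) α)))))
      (vtr_comp (vtr_pre (K_AB_C_D T) α) (vtr_pre (K_A_B_CD T) α));
  md_middle :
    vtr_eq
      (vtr_comp (vtr_pre (K_A_I_B I) α)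
                (vtr_post T (vtr_prod (vtr_id (fid D)) λ)))
      (vtr_post T (vtr_prod ρ (vtr_id (fid D))));
  md_left :
    vtr_eq
      (vtr_comp (vtr_pre (K_I_A_B I) α) (vtr_pre T λ))
      (vtr_post T (vtr_prod λ (vtr_id (fid D))));
  md_right :
    vtr_eq
      (vtr_comp (vtr_pre (K_A_B_I I) α)
                (vtr_post T (vtr_prod (vtr_id (fid D)) ρ)))
      (vtr_pre T ρ)
}.

(** * Horizontally monoidal double categories *)

Section HorizontallyMonoidal.
Variables (D : dbl) (T : pdf (D × D) D) (I : pdf dunit D).
Variables (α : htr (D × D × D) D) (λ ρ : htr D D).

(** The transformations between which [p], [m], [l] and [r] are modifications. *)
Definition pent3 : htr (D × D × D × D) D :=
  (* (α_{A,B,C}⊗D) ⋅ (α_{A,B⊗C,D} ⋅ (A⊗α_{B,C,D})) *)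
  htr_comp
    (htr_post T (fprod (assocL T) (fid D)) (fprod (assocR T) (fid D))
       (htr_prod α (htr_id (fid D))))
    (htr_comp (htr_pre (K_A_BC_D T) α)
       (htr_pre (K_A'BCD D)
          (htr_post T (fprod (fid D) (assocL T)) (fprod (fid D) (assocR T))
             (htr_prod (htr_id (fid D)) α)))).
Definition pent2 : htr (D × D × D × D) D :=
  (* α_{A⊗B,C,D} ⋅ α_{A,B,C⊗D} *)
  htr_comp (htr_pre (K_AB_C_D T) α) (htr_pre (K_A_B_CD T) α).

Definition A_λB : htr (D × D) D :=
  htr_post T (fprod (fid D) (unitL T I)) (fprod (fid D) (fid D))
    (htr_prod (htr_id (fid D)) λ).
Definition A_ρB : htr (D × D) D :=
  htr_post T (fprod (fid D) (unitR T I)) (fprod (fid D) (fid D))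
    (htr_prod (htr_id (fid D)) ρ).
Definition λA_B : htr (D × D) D :=
  htr_post T (fprod (unitL T I) (fid D)) (fprod (fid D) (fid D))
    (htr_prod λ (htr_id (fid D))).
Definition ρA_B : htr (D × D) D :=
  htr_post T (fprod (unitR T I) (fid D)) (fprod (fid D) (fid D))
    (htr_prod ρ (htr_id (fid D))).

Variables (p : Ob (D × D × D × D) -> Sq D) (m l r : Ob (D × D) -> Sq D).

Let Tob (A B : Ob D) : Ob D := fO T (A, B).
Let T1 (f g : Hc D) : Hc D := fH T (f, g).
Let T2 (a b : Sq D) : Sq D := fS T (a, b).
Let one : Ob D := fO I tt.
Let a_ (A B C : Ob D) : Hc D := hO α (A, B, C).
Let δ_ (f g h : Hc D) : Sq D := hδ α (f, g, h).
Let p_ (A B C E : Ob D) : Sq D := p (A, B, C, E).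
Let m_ (A B : Ob D) : Sq D := m (A, B).
Let l_ (A B : Ob D) : Sq D := l (A, B).
Let r_ (A B : Ob D) : Sq D := r (A, B).

Notation "A ⊗ B" := (Tob A B) (at level 38, left associativity).
Notation "x ⊗R E" := (T1 x (hid E)) (at level 38, left associativity).
Notation "A ⊗L x" := (T1 (hid A) x) (at level 37, right associativity).

(** The images of 2-cells [x⋅y => z] and [x⋅y⋅z => x'⋅y'] under [-⊗E] and
    [A⊗-], pasted with compositors of [⊗] so as to become 2-cells
    [(x⊗E)⋅(y⊗E) => z⊗E], [(x⊗E)⋅(y⊗E)⋅(z⊗E) => (x'⊗E)⋅(y'⊗E)], and similarly
    for [A⊗-]. *)
Let R21 (E : Ob D) (x y : Hc D) (a : Sq D) : Sq D :=
  fc T (x, hid E) (y, hid E) ⫽ T2 a (sqH (hid E)).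
Let L21 (A : Ob D) (x y : Hc D) (a : Sq D) : Sq D :=
  fc T (hid A, x) (hid A, y) ⫽ T2 (sqH (hid A)) a.
Let R32 (E : Ob D) (x y z x' y' : Hc D) (a : Sq D) : Sq D :=
  (fc T (x, hid E) (y, hid E) ∥ sqH (z ⊗R E))
  ⫽ R21 E (x ⋅ y) z a ⫽ fci T (x', hid E) (y', hid E).
Let L32 (A : Ob D) (x y z x' y' : Hc D) (a : Sq D) : Sq D :=
  (fc T (hid A, x) (hid A, y) ∥ sqH (A ⊗L z))
  ⫽ L21 A (x ⋅ y) z a ⫽ fci T (hid A, x') (hid A, y').

(** Nonabelian 4-cocycle condition.  Both sides are 2-cells from
    [((α_{A,B,C}⊗H)⊗E)⋅(α_{A,BC,H}⊗E)⋅((A⊗α_{B,C,H})⊗E)⋅α_{A,B(CH),E}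
       ⋅(A⊗α_{B,CH,E})⋅(A⊗(B⊗α_{C,H,E}))]
    to [α_{(AB)C,H,E}⋅α_{AB,C,HE}⋅α_{A,B,C(HE)}].  [d] is the inverse of the
    2-cell [δ] of [α] at [(id_A,id_B,α_{C,H,E})]; unitors of [⊗] identify
    [id_A⊗id_B] with [id_{A⊗B}]. *)
Definition TA1 : Prop := forall (A B C H E : Ob D) (d : Sq D),
  vinverse (δ_ (hid A) (hid B) (a_ C H E)) d ->
    (R32 E (a_ A B C ⊗R H) (a_ A (B ⊗ C) H) (A ⊗L a_ B C H)
           (a_ (A ⊗ B) C H) (a_ A B (C ⊗ H)) (p_ A B C H)
       ∥ sqH (a_ A (B ⊗ (C ⊗ H)) E)
       ∥ sqH (A ⊗L a_ B (C ⊗ H) E) ∥ sqH (A ⊗L B ⊗L a_ C H E))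
  ⫽ (sqH (a_ (A ⊗ B) C H ⊗R E)
       ∥ p_ A B (C ⊗ H) E
       ∥ sqH (A ⊗L B ⊗L a_ C H E))
  ⫽ (sqH (a_ (A ⊗ B) C H ⊗R E) ∥ sqH (a_ (A ⊗ B) (C ⊗ H) E)
       ∥ d)
  ⫽ (sqH (a_ (A ⊗ B) C H ⊗R E) ∥ sqH (a_ (A ⊗ B) (C ⊗ H) E)
       ∥ T2 (fui T (A, B)) (sqH (a_ C H E))
       ∥ sqH (a_ A B (C ⊗ (H ⊗ E))))
  ⫽ (p_ (A ⊗ B) C H E
       ∥ sqH (a_ A B (C ⊗ (H ⊗ E))))
  =
    (sqH (a_ A B C ⊗R H ⊗R E) ∥ sqH (a_ A (B ⊗ C) H ⊗R E)
       ∥ δ_ (hid A) (a_ B C H) (hid E)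
       ∥ sqH (A ⊗L a_ B (C ⊗ H) E) ∥ sqH (A ⊗L B ⊗L a_ C H E))
  ⫽ (sqH (a_ A B C ⊗R H ⊗R E) ∥ sqH (a_ A (B ⊗ C) H ⊗R E)
       ∥ sqH (a_ A (B ⊗ C ⊗ H) E)
       ∥ L32 A (a_ B C H ⊗R E) (a_ B (C ⊗ H) E) (B ⊗L a_ C H E)
               (a_ (B ⊗ C) H E) (a_ B C (H ⊗ E)) (p_ B C H E))
  ⫽ (sqH (a_ A B C ⊗R H ⊗R E)
       ∥ p_ A (B ⊗ C) H E
       ∥ sqH (A ⊗L a_ B C (H ⊗ E)))
  ⫽ (δ_ (a_ A B C) (hid H) (hid E)
       ∥ sqH (a_ A (B ⊗ C) (H ⊗ E)) ∥ sqH (A ⊗L a_ B C (H ⊗ E)))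
  ⫽ (sqH (a_ (A ⊗ B ⊗ C) H E)
       ∥ T2 (sqH (a_ A B C)) (fui T (H, E))
       ∥ sqH (a_ A (B ⊗ C) (H ⊗ E)) ∥ sqH (A ⊗L a_ B C (H ⊗ E)))
  ⫽ (sqH (a_ (A ⊗ B ⊗ C) H E)
       ∥ p_ A B C (H ⊗ E)).

(** Left normalization.  Both sides are 2-cells from
    [(α_{A,I,B}⊗C)⋅α_{A,IB,C}⋅(A⊗α_{I,B,C})⋅(A⊗λ_{BC})] to
    [((ρ_A⊗B)⊗C)⋅α_{A,B,C}]; [d] and [e] are inverses of 2-cells [δ] of [α]. *)
Definition TA2 : Prop := forall (A B C : Ob D) (d e : Sq D),
  vinverse (δ_ (hid A) (hO λ B) (hid C)) d ->
  vinverse (δ_ (hO ρ A) (hid B) (hid C)) e ->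
    (sqH (a_ A one B ⊗R C) ∥ sqH (a_ A (one ⊗ B) C)
       ∥ L21 A (a_ one B C) (hO λ (B ⊗ C)) (l_ B C))
  ⫽ (sqH (a_ A one B ⊗R C)
       ∥ d)
  ⫽ (R21 C (a_ A one B) (A ⊗L hO λ B) (m_ A B)
       ∥ sqH (a_ A B C))
  =
    (p_ A one B C
       ∥ sqH (A ⊗L hO λ (B ⊗ C)))
  ⫽ (sqH (a_ (A ⊗ one) B C)
       ∥ m_ A (B ⊗ C))
  ⫽ (sqH (a_ (A ⊗ one) B C)
       ∥ T2 (sqH (hO ρ A)) (fu T (B, C)))
  ⫽ e.

(** Right normalization.  Both sides are 2-cells from
    [(α_{A,B,I}⊗C)⋅α_{A,BI,C}⋅(A⊗α_{B,I,C})⋅(A⊗(B⊗λ_C))] to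
    [(ρ_{AB}⊗C)⋅α_{A,B,C}]; [d] and [e] are inverses of 2-cells [δ] of [α]. *)
Definition TA3 : Prop := forall (A B C : Ob D) (d e : Sq D),
  vinverse (δ_ (hid A) (hO ρ B) (hid C)) d ->
  vinverse (δ_ (hid A) (hid B) (hO λ C)) e ->
    (sqH (a_ A B one ⊗R C) ∥ sqH (a_ A (B ⊗ one) C)
       ∥ L21 A (a_ B one C) (B ⊗L hO λ C) (m_ B C))
  ⫽ (sqH (a_ A B one ⊗R C)
       ∥ d)
  ⫽ (R21 C (a_ A B one) (A ⊗L hO ρ B) (r_ A B)
       ∥ sqH (a_ A B C))
  =
    (p_ A B one C
       ∥ sqH (A ⊗L B ⊗L hO λ C))
  ⫽ (sqH (a_ (A ⊗ B) one C)
       ∥ e)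
  ⫽ (sqH (a_ (A ⊗ B) one C)
       ∥ T2 (fui T (A, B)) (sqH (hO λ C))
       ∥ sqH (a_ A B C))
  ⫽ (m_ (A ⊗ B) C
       ∥ sqH (a_ A B C)).

Record is_horizontally_monoidal : Prop := {
  hm_dbl : is_dbl D;
  hm_T : is_pdf T;
  hm_I : is_pdf I;
  hm_α : is_horizontal_equivalence (assocL T) (assocR T) α;
  hm_λ : is_horizontal_equivalence (unitL T I) (fid D) λ;
  hm_ρ : is_horizontal_equivalence (unitR T I) (fid D) ρ;
  hm_p : is_inv_modification (quadL T) (quadR T) pent3 pent2 p;
  hm_m : is_inv_modification (pairRI T I) T
           (htr_comp (htr_pre (K_A_I_B I) α) A_λB) ρA_B m;
  hm_l : is_inv_modification (pairLI T I) T
           (htr_comp (htr_pre (K_I_A_B I) α) (htr_pre T λ)) λA_B l;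
  hm_r : is_inv_modification (pairIR T I) T
           (htr_comp (htr_pre (K_A_B_I I) α) A_ρB) (htr_pre T ρ) r;
  hm_TA1 : TA1;
  hm_TA2 : TA2;
  hm_TA3 : TA3
}.

End HorizontallyMonoidal.

(* Main.v *)
Require Import Defs.
From Stdlib Require Import ProofIrrelevance IndefiniteDescription.
Local Open Scope dbl_scope.
Set Implicit Arguments.
Unset Strict Implicit.
Unset Printing Implicit Defensive.

(** A companion of a 1v-cell is determined, up to a unique globular 2-cell
    compatible with the binding cells [ε], by the 1v-cell.  Companions compose,
    are preserved by pseudodouble functors, and the compositors, unitors and
    the cells [δ] of a companion-lift at a companion are again such unique
    comparisons.  The strict pentagon and triangles say that the 1h-composites
    related by [p], [m], [l], [r] are companions of the same 1v-cells, so these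
    modifications are taken to be the comparisons; their axioms and those of
    a companion-lift follow by cancelling [ε].  Both sides of each of
    (TA1)-(TA3) are pasted from comparisons, hence are comparisons between the
    same two companions, hence equal. *)

(* Cancelling [eps] suffices because [η|ε] = Id recovers a cell ending in a companion from its left
   side and its pasting with [eps]. Cells ending in a companion followed by a further 1h-cell are
   recovered in the same way, which covers the cells [δ]. The same cancellation shows that [eps]
   determines the whole companion, [eta] included. Composition of companions is therefore
   associative as an equality of records, so rows of a pasting that are bracketed differently still
   fit together. That the components of a lift are equivalences needs a separate argument: a
   companion of the inverse 1v-cell composes with the given one to companions of identities, and
   identity 1h-cells are such companions as well. *)
Existing Class is_dbl.
Existing Class is_pdf.
#[local] Hint Mode is_dbl ! : typeclass_instances.
#[local] Hint Mode is_pdf - - ! : typeclass_instances.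

(** * Boundaries and unit laws *)

Section Boundaries.
Context {D : dbl} {HD : is_dbl D}.

Lemma hsrc_hid (A : Ob D) : hsrc (hid A) = A. Proof. apply (hid_bd HD). Qed.
Lemma htgt_hid (A : Ob D) : htgt (hid A) = A. Proof. apply (hid_bd HD). Qed.
Lemma vsrc_vid (A : Ob D) : vsrc (vid A) = A. Proof. apply (vid_bd HD). Qed.
Lemma vtgt_vid (A : Ob D) : vtgt (vid A) = A. Proof. apply (vid_bd HD). Qed.
Lemma hsrc_hcomp (f g : Hc D) : htgt f = hsrc g -> hsrc (f ⋅ g) = hsrc f.
Proof. intros e; apply (hcomp_bd HD e). Qed.
Lemma htgt_hcomp (f g : Hc D) : htgt f = hsrc g -> htgt (f ⋅ g) = htgt g.
Proof. intros e; apply (hcomp_bd HD e). Qed.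
Lemma vsrc_vcomp (u v : Vc D) : vtgt u = vsrc v -> vsrc (vcomp u v) = vsrc u.
Proof. intros e; apply (vcomp_bd HD e). Qed.
Lemma vtgt_vcomp (u v : Vc D) : vtgt u = vsrc v -> vtgt (vcomp u v) = vtgt v.
Proof. intros e; apply (vcomp_bd HD e). Qed.
Lemma hcomp_hid_l (A : Ob D) (f : Hc D) : hsrc f = A -> hid A ⋅ f = f.
Proof. intros <-; apply (hcomp_1l HD). Qed.
Lemma hcomp_hid_r (A : Ob D) (f : Hc D) : htgt f = A -> f ⋅ hid A = f.
Proof. intros <-; apply (hcomp_1r HD). Qed.
Lemma vcomp_vid_l (A : Ob D) (u : Vc D) : vsrc u = A -> vcomp (vid A) u = u.
Proof. intros <-; apply (vcomp_1l HD). Qed.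
Lemma vcomp_vid_r (A : Ob D) (u : Vc D) : vtgt u = A -> vcomp u (vid A) = u.
Proof. intros <-; apply (vcomp_1r HD). Qed.

Lemma top_sqH (f : Hc D) : top (sqH f) = f. Proof. apply (sqH_bd HD). Qed.
Lemma bot_sqH (f : Hc D) : bot (sqH f) = f. Proof. apply (sqH_bd HD). Qed.
Lemma lft_sqH (f : Hc D) : lft (sqH f) = vid (hsrc f).
Proof. apply (sqH_bd HD). Qed.
Lemma rgt_sqH (f : Hc D) : rgt (sqH f) = vid (htgt f).
Proof. apply (sqH_bd HD). Qed.
Lemma top_sqV (u : Vc D) : top (sqV u) = hid (vsrc u).
Proof. apply (sqV_bd HD). Qed.
Lemma bot_sqV (u : Vc D) : bot (sqV u) = hid (vtgt u).
Proof. apply (sqV_bd HD). Qed.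
Lemma lft_sqV (u : Vc D) : lft (sqV u) = u. Proof. apply (sqV_bd HD). Qed.
Lemma rgt_sqV (u : Vc D) : rgt (sqV u) = u. Proof. apply (sqV_bd HD). Qed.

Section Composites.
Context (a b : Sq D).
Lemma top_hcs : rgt a = lft b -> top (a ∥ b) = top a ⋅ top b.
Proof. intros e; apply (hcs_bd HD e). Qed.
Lemma bot_hcs : rgt a = lft b -> bot (a ∥ b) = bot a ⋅ bot b.
Proof. intros e; apply (hcs_bd HD e). Qed.
Lemma lft_hcs : rgt a = lft b -> lft (a ∥ b) = lft a.
Proof. intros e; apply (hcs_bd HD e). Qed.
Lemma rgt_hcs : rgt a = lft b -> rgt (a ∥ b) = rgt b.
Proof. intros e; apply (hcs_bd HD e). Qed.
Lemma top_vcs : bot a = top b -> top (a ⫽ b) = top a.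
Proof. intros e; apply (vcs_bd HD e). Qed.
Lemma bot_vcs : bot a = top b -> bot (a ⫽ b) = bot b.
Proof. intros e; apply (vcs_bd HD e). Qed.
Lemma lft_vcs : bot a = top b -> lft (a ⫽ b) = vcomp (lft a) (lft b).
Proof. intros e; apply (vcs_bd HD e). Qed.
Lemma rgt_vcs : bot a = top b -> rgt (a ⫽ b) = vcomp (rgt a) (rgt b).
Proof. intros e; apply (vcs_bd HD e). Qed.
End Composites.

Lemma sqV_hcs (u : Vc D) (a : Sq D) : lft a = u -> sqV u ∥ a = a.
Proof. intros <-; apply (hcs_1l HD). Qed.
Lemma hcs_sqV (u : Vc D) (a : Sq D) : rgt a = u -> a ∥ sqV u = a.
Proof. intros <-; apply (hcs_1r HD). Qed.
Lemma sqH_vcs (f : Hc D) (a : Sq D) : top a = f -> sqH f ⫽ a = a.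
Proof. intros <-; apply (vcs_1l HD). Qed.
Lemma vcs_sqH (f : Hc D) (a : Sq D) : bot a = f -> a ⫽ sqH f = a.
Proof. intros <-; apply (vcs_1r HD). Qed.
Lemma hid_hcs (A : Ob D) (a : Sq D) : lft a = vid A -> sqH (hid A) ∥ a = a.
Proof. rewrite (sqH_hid HD); apply sqV_hcs. Qed.
Lemma hcs_hid (A : Ob D) (a : Sq D) : rgt a = vid A -> a ∥ sqH (hid A) = a.
Proof. rewrite (sqH_hid HD); apply hcs_sqV. Qed.

End Boundaries.

(** The endpoints are indices, so composability of companions is a matter of typing, whereas cells
    of a [dbl] have boundaries only up to provable equality. The 1v-cell is a field, so that
    companions of provably equal 1v-cells lie in one type and are compared without transport. *)
Record Cp (D : dbl) (A B : Ob D) : Type := MkCp {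
  vert : Vc D;
  arr : Hc D;
  eps : Sq D;
  eta : Sq D;
  vert_bd : isV vert A B;
  cp_companion : is_companion vert arr eps eta
}.

Section CompanionBoundaries.
Context {D : dbl} {A B : Ob D} (e : Cp A B).
Lemma vsrc_vert : vsrc (vert e) = A. Proof. apply e. Qed.
Lemma vtgt_vert : vtgt (vert e) = B. Proof. apply e. Qed.
Lemma hsrc_arr : hsrc (arr e) = A.
Proof. destruct e as [? ? ? ? [] []]; simpl in *; destruct comp_bd; congruence. Qed.
Lemma htgt_arr : htgt (arr e) = B.
Proof. destruct e as [? ? ? ? [] []]; simpl in *; destruct comp_bd; congruence. Qed.
Lemma top_eps : top (eps e) = arr e. Proof. apply (comp_ε (cp_companion e)). Qed.
Lemma lft_eps : lft (eps e) = vert e. Proof. apply (comp_ε (cp_companion e)). Qed.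
Lemma bot_eps : bot (eps e) = hid B.
Proof. destruct e as [? ? ? ? [] c]; simpl; subst; apply (comp_ε c). Qed.
Lemma rgt_eps : rgt (eps e) = vid B.
Proof. destruct e as [? ? ? ? [] c]; simpl; subst; apply (comp_ε c). Qed.
Lemma bot_eta : bot (eta e) = arr e. Proof. apply (comp_η (cp_companion e)). Qed.
Lemma rgt_eta : rgt (eta e) = vert e. Proof. apply (comp_η (cp_companion e)). Qed.
Lemma top_eta : top (eta e) = hid A.
Proof. destruct e as [? ? ? ? [] c]; simpl; subst; apply (comp_η c). Qed.
Lemma lft_eta : lft (eta e) = vid A.
Proof. destruct e as [? ? ? ? [] c]; simpl; subst; apply (comp_η c). Qed.
End CompanionBoundaries.

(** [vinverse] constrains only tops and bottoms. The sides of [b] are read off from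
    [a ⫽ b = sqH (top a)], since the sides of [a] are identities. *)
Lemma glob_vinverse {D : dbl} {HD : is_dbl D} (a b : Sq D) (f g : Hc D) :
  glob a f g -> vinverse a b -> glob b g f.
Proof.
  intros (Ht & Hb & Hl & Hr) (H1 & H2 & H3 & H4).
  assert (Sf : hsrc f = hsrc g) by (rewrite <- Ht, <- Hb, (sq_nw HD), (sq_sw HD), Hl, vsrc_vid, vtgt_vid; reflexivity).
  assert (Tf : htgt f = htgt g) by (rewrite <- Ht, <- Hb, (sq_ne HD), (sq_se HD), Hr, vsrc_vid, vtgt_vid; reflexivity).
  assert (lft b = vid (hsrc g)).
  { transitivity (lft (a ⫽ b)).
    - rewrite lft_vcs, Hl, vcomp_vid_l; trivial.
      rewrite <- (sq_nw HD); congruence.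
    - rewrite H3, lft_sqH; congruence. }
  assert (rgt b = vid (htgt g)).
  { transitivity (rgt (a ⫽ b)).
    - rewrite rgt_vcs, Hr, vcomp_vid_l; trivial.
      rewrite <- (sq_ne HD); congruence.
    - rewrite H3, rgt_sqH; congruence. }
  repeat split; congruence.
Qed.

Section FunctorBoundaries.
Context {D E : dbl} {HD : is_dbl D} {HE : is_dbl E} (F : pdf D E) {HF : is_pdf F}.

Lemma hsrc_fH f : hsrc (fH F f) = fO F (hsrc f). Proof. apply (fH_bd HF). Qed.
Lemma htgt_fH f : htgt (fH F f) = fO F (htgt f). Proof. apply (fH_bd HF). Qed.
Lemma vsrc_fV u : vsrc (fV F u) = fO F (vsrc u). Proof. apply (fV_bd HF). Qed.
Lemma vtgt_fV u : vtgt (fV F u) = fO F (vtgt u). Proof. apply (fV_bd HF). Qed.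
Lemma top_fS a : top (fS F a) = fH F (top a). Proof. apply (fS_bd HF). Qed.
Lemma bot_fS a : bot (fS F a) = fH F (bot a). Proof. apply (fS_bd HF). Qed.
Lemma lft_fS a : lft (fS F a) = fV F (lft a). Proof. apply (fS_bd HF). Qed.
Lemma rgt_fS a : rgt (fS F a) = fV F (rgt a). Proof. apply (fS_bd HF). Qed.
Lemma top_fu A : top (fu F A) = hid (fO F A). Proof. apply (fu_bd HF). Qed.
Lemma bot_fu A : bot (fu F A) = fH F (hid A). Proof. apply (fu_bd HF). Qed.
Lemma lft_fu A : lft (fu F A) = vid (fO F A).
Proof. destruct (fu_bd HF A) as (_ & _ & -> & _). now rewrite hsrc_hid. Qed.
Lemma rgt_fu A : rgt (fu F A) = vid (fO F A).
Proof. destruct (fu_bd HF A) as (_ & _ & _ & ->). now rewrite htgt_hid. Qed.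
Lemma glob_fui A : glob (fui F A) (fH F (hid A)) (hid (fO F A)).
Proof. exact (glob_vinverse (fu_bd HF A) (fu_inv HF A)). Qed.
Lemma top_fui A : top (fui F A) = fH F (hid A). Proof. apply glob_fui. Qed.
Lemma bot_fui A : bot (fui F A) = hid (fO F A). Proof. apply glob_fui. Qed.
Lemma lft_fui A : lft (fui F A) = vid (fO F A).
Proof. destruct (glob_fui A) as (_ & _ & -> & _). now rewrite hsrc_fH, hsrc_hid. Qed.
Lemma rgt_fui A : rgt (fui F A) = vid (fO F A).
Proof. destruct (glob_fui A) as (_ & _ & _ & ->). now rewrite htgt_fH, htgt_hid. Qed.

Section Compositors.
Context (f g : Hc D) (fg : htgt f = hsrc g).
Lemma top_fc : top (fc F f g) = fH F f ⋅ fH F g. Proof. apply (fc_bd HF fg). Qed.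
Lemma bot_fc : bot (fc F f g) = fH F (f ⋅ g). Proof. apply (fc_bd HF fg). Qed.
Lemma lft_fc : lft (fc F f g) = vid (fO F (hsrc f)).
Proof.
  destruct (fc_bd HF fg) as (_ & _ & -> & _).
  now rewrite hsrc_hcomp, hsrc_fH by now rewrite htgt_fH, hsrc_fH, fg.
Qed.
Lemma rgt_fc : rgt (fc F f g) = vid (fO F (htgt g)).
Proof.
  destruct (fc_bd HF fg) as (_ & _ & _ & ->).
  now rewrite htgt_hcomp, htgt_fH by now rewrite htgt_fH, hsrc_fH, fg.
Qed.
Lemma glob_fci : glob (fci F f g) (fH F (f ⋅ g)) (fH F f ⋅ fH F g).
Proof. exact (glob_vinverse (fc_bd HF fg) (fc_inv HF fg)). Qed.
Lemma top_fci : top (fci F f g) = fH F (f ⋅ g). Proof. apply glob_fci. Qed.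
Lemma bot_fci : bot (fci F f g) = fH F f ⋅ fH F g. Proof. apply glob_fci. Qed.
Lemma lft_fci : lft (fci F f g) = vid (fO F (hsrc f)).
Proof.
  destruct glob_fci as (_ & _ & -> & _). now rewrite hsrc_fH, hsrc_hcomp.
Qed.
Lemma rgt_fci : rgt (fci F f g) = vid (fO F (htgt g)).
Proof.
  destruct glob_fci as (_ & _ & _ & ->). now rewrite htgt_fH, htgt_hcomp.
Qed.
End Compositors.
End FunctorBoundaries.

Ltac hyps := repeat match goal with
  | H : isSq _ _ _ _ _ |- _ => destruct H as (? & ? & ? & ?)
  | H : glob _ _ _ |- _ => destruct H as (? & ? & ? & ?)
  | H : isH _ _ _ |- _ => destruct H
  | H : isV _ _ _ |- _ => destruct H
  end.

(* [bd] proves equations between boundaries, discharging the composability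
   conditions of its rewriting rules by recursion; hypotheses [top a = f] etc.
   are used as rewriting rules from left to right. *)
Ltac bd_step tac := match goal with
  | |- context [hsrc (hid _)] => rewrite hsrc_hid
  | |- context [htgt (hid _)] => rewrite htgt_hid
  | |- context [vsrc (vid _)] => rewrite vsrc_vid
  | |- context [vtgt (vid _)] => rewrite vtgt_vid
  | |- context [top (sqH _)] => rewrite top_sqH
  | |- context [bot (sqH _)] => rewrite bot_sqH
  | |- context [lft (sqH _)] => rewrite lft_sqH
  | |- context [rgt (sqH _)] => rewrite rgt_sqH
  | |- context [top (sqV _)] => rewrite top_sqV
  | |- context [bot (sqV _)] => rewrite bot_sqV
  | |- context [lft (sqV _)] => rewrite lft_sqV
  | |- context [rgt (sqV _)] => rewrite rgt_sqV
  | |- context [vsrc (vert ?e)] => rewrite (vsrc_vert e)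
  | |- context [vtgt (vert ?e)] => rewrite (vtgt_vert e)
  | |- context [hsrc (arr ?e)] => rewrite (hsrc_arr e)
  | |- context [htgt (arr ?e)] => rewrite (htgt_arr e)
  | |- context [top (eps ?e)] => rewrite (top_eps e)
  | |- context [bot (eps ?e)] => rewrite (bot_eps e)
  | |- context [lft (eps ?e)] => rewrite (lft_eps e)
  | |- context [rgt (eps ?e)] => rewrite (rgt_eps e)
  | |- context [top (eta ?e)] => rewrite (top_eta e)
  | |- context [bot (eta ?e)] => rewrite (bot_eta e)
  | |- context [lft (eta ?e)] => rewrite (lft_eta e)
  | |- context [rgt (eta ?e)] => rewrite (rgt_eta e)
  | |- context [hsrc (fH ?F _)] => rewrite (hsrc_fH (F:=F))
  | |- context [htgt (fH ?F _)] => rewrite (htgt_fH (F:=F))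
  | |- context [vsrc (fV ?F _)] => rewrite (vsrc_fV (F:=F))
  | |- context [vtgt (fV ?F _)] => rewrite (vtgt_fV (F:=F))
  | |- context [top (fS ?F _)] => rewrite (top_fS (F:=F))
  | |- context [bot (fS ?F _)] => rewrite (bot_fS (F:=F))
  | |- context [lft (fS ?F _)] => rewrite (lft_fS (F:=F))
  | |- context [rgt (fS ?F _)] => rewrite (rgt_fS (F:=F))
  | |- context [top (fu ?F _)] => rewrite (top_fu (F:=F))
  | |- context [bot (fu ?F _)] => rewrite (bot_fu (F:=F))
  | |- context [lft (fu ?F _)] => rewrite (lft_fu (F:=F))
  | |- context [rgt (fu ?F _)] => rewrite (rgt_fu (F:=F))
  | |- context [top (fui ?F _)] => rewrite (top_fui (F:=F))
  | |- context [bot (fui ?F _)] => rewrite (bot_fui (F:=F))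
  | |- context [lft (fui ?F _)] => rewrite (lft_fui (F:=F))
  | |- context [rgt (fui ?F _)] => rewrite (rgt_fui (F:=F))
  | |- context [top (fc ?F ?f ?g)] => rewrite (top_fc (F:=F) (f:=f) (g:=g)) by tac
  | |- context [bot (fc ?F ?f ?g)] => rewrite (bot_fc (F:=F) (f:=f) (g:=g)) by tac
  | |- context [lft (fc ?F ?f ?g)] => rewrite (lft_fc (F:=F) (f:=f) (g:=g)) by tac
  | |- context [rgt (fc ?F ?f ?g)] => rewrite (rgt_fc (F:=F) (f:=f) (g:=g)) by tac
  | |- context [top (fci ?F ?f ?g)] => rewrite (top_fci (F:=F) (f:=f) (g:=g)) by tac
  | |- context [bot (fci ?F ?f ?g)] => rewrite (bot_fci (F:=F) (f:=f) (g:=g)) by tac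
  | |- context [lft (fci ?F ?f ?g)] => rewrite (lft_fci (F:=F) (f:=f) (g:=g)) by tac
  | |- context [rgt (fci ?F ?f ?g)] => rewrite (rgt_fci (F:=F) (f:=f) (g:=g)) by tac
  | |- context [fV ?F (vid ?A)] => rewrite (fV_vid (F:=F) _ A)
  | H : top ?a = _ |- context [top ?a] => rewrite H
  | H : bot ?a = _ |- context [bot ?a] => rewrite H
  | H : lft ?a = _ |- context [lft ?a] => rewrite H
  | H : rgt ?a = _ |- context [rgt ?a] => rewrite H
  | H : hsrc ?a = _ |- context [hsrc ?a] => rewrite H
  | H : htgt ?a = _ |- context [htgt ?a] => rewrite H
  | H : vsrc ?a = _ |- context [vsrc ?a] => rewrite H
  | H : vtgt ?a = _ |- context [vtgt ?a] => rewrite H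
  | |- context [top (?a ∥ ?b)] => rewrite (@top_hcs _ _ a b) by tac
  | |- context [bot (?a ∥ ?b)] => rewrite (@bot_hcs _ _ a b) by tac
  | |- context [lft (?a ∥ ?b)] => rewrite (@lft_hcs _ _ a b) by tac
  | |- context [rgt (?a ∥ ?b)] => rewrite (@rgt_hcs _ _ a b) by tac
  | |- context [top (?a ⫽ ?b)] => rewrite (@top_vcs _ _ a b) by tac
  | |- context [bot (?a ⫽ ?b)] => rewrite (@bot_vcs _ _ a b) by tac
  | |- context [lft (?a ⫽ ?b)] => rewrite (@lft_vcs _ _ a b) by tac
  | |- context [rgt (?a ⫽ ?b)] => rewrite (@rgt_vcs _ _ a b) by tac
  | |- context [hid ?A ⋅ ?f] => rewrite (@hcomp_hid_l _ _ A f) by tac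
  | |- context [?f ⋅ hid ?A] => rewrite (@hcomp_hid_r _ _ A f) by tac
  | |- context [vcomp (vid ?A) ?f] => rewrite (@vcomp_vid_l _ _ A f) by tac
  | |- context [vcomp ?f (vid ?A)] => rewrite (@vcomp_vid_r _ _ A f) by tac
  | |- context [hsrc (?f ⋅ ?g)] => rewrite (@hsrc_hcomp _ _ f g) by tac
  | |- context [htgt (?f ⋅ ?g)] => rewrite (@htgt_hcomp _ _ f g) by tac
  | |- context [vsrc (vcomp ?f ?g)] => rewrite (@vsrc_vcomp _ _ f g) by tac
  | |- context [vtgt (vcomp ?f ?g)] => rewrite (@vtgt_vcomp _ _ f g) by tac
  | |- context [?f ⋅ ?g ⋅ ?h] => rewrite (@hcomp_assoc _ _ f g h) by tac
  | |- context [vcomp (vcomp ?u ?v) ?w] => rewrite (@vcomp_assoc _ _ u v w) by tac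
  | |- context [hsrc (top ?a)] => rewrite (sq_nw _ a)
  | |- context [htgt (top ?a)] => rewrite (sq_ne _ a)
  | |- context [hsrc (bot ?a)] => rewrite (sq_sw _ a)
  | |- context [htgt (bot ?a)] => rewrite (sq_se _ a)
  end.
Ltac bdn := repeat bd_step ltac:(bd)
with bd := solve [repeat match goal with
  | |- _ /\ _ => split
  | |- isSq _ _ _ _ _ => unfold isSq
  | |- glob _ _ _ => unfold glob
  | |- isH _ _ _ => unfold isH
  | |- isV _ _ _ => unfold isV
  end; bdn; congruence].

(** * Companions and their comparisons *)

Section Companions.
Context {D : dbl} {HD : is_dbl D}.

Lemma eta_eps {A B : Ob D} (e : Cp A B) : eta e ∥ eps e = sqH (arr e).
Proof. apply (cp_companion e). Qed.
Lemma eta_vcs_eps {A B : Ob D} (e : Cp A B) : eta e ⫽ eps e = sqV (vert e).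
Proof. apply (cp_companion e). Qed.

(** By interchange the right-hand side is [X] above [η|ε|Id_g], and [η|ε] = Id makes the lower row
    an identity. *)
Lemma square_of_eps {A B : Ob D} (e : Cp A B) (g : Hc D) (X : Sq D) :
  bot X = arr e ⋅ g -> hsrc g = B ->
  X = (sqV (lft X) ⫽ eta e) ∥ (X ⫽ (eps e ∥ sqH g)).
Proof.
  intros HX Hg.
  assert (vtgt (lft X) = A) by (rewrite <- (sq_sw HD), HX; bd).
  rewrite <- (interchange HD) by bd.
  rewrite <- (hcs_assoc HD) by bd.
  rewrite (hcs_1l HD), eta_eps, <- (sqH_hcomp HD) by bd.
  now rewrite vcs_sqH.
Qed.

(** Only the left sides have to agree, so the cancellation serves the squares α^u as well as
    globular cells. The factor [g] is there for [δ], whose bottom is a companion followed by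
    G(f). *)
Lemma cancel_eps_hcs {A B : Ob D} (e : Cp A B) (g : Hc D) (X Y : Sq D) :
  bot X = arr e ⋅ g -> bot Y = arr e ⋅ g -> hsrc g = B -> lft X = lft Y ->
  X ⫽ (eps e ∥ sqH g) = Y ⫽ (eps e ∥ sqH g) -> X = Y.
Proof.
  intros HX HY Hg Hl E.
  now rewrite (square_of_eps HX Hg), (square_of_eps HY Hg), Hl, E.
Qed.

Lemma cancel_eps {A B : Ob D} (e : Cp A B) (X Y : Sq D) :
  bot X = arr e -> bot Y = arr e -> lft X = lft Y ->
  X ⫽ eps e = Y ⫽ eps e -> X = Y.
Proof.
  intros HX HY Hl E.
  apply (@cancel_eps_hcs A B e (hid B)); try bd.
  now rewrite hcs_hid by bd.
Qed.

(** ε has the 1v-cell as its left side and the 1h-cell as its top, and by cancellation η is the only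
    cell of its boundary with η/ε = Id^u. Equality of companions thus becomes a single equation of
    squares. *)
Lemma Cp_eq {A B : Ob D} (e e' : Cp A B) : eps e = eps e' -> e = e'.
Proof.
  intros E.
  assert (Ev : vert e = vert e') by (rewrite <- (lft_eps e), E; bd).
  assert (Ea : arr e = arr e') by (rewrite <- (top_eps e), E; bd).
  assert (Et : eta e = eta e').
  { apply (@cancel_eps _ _ e); try bd.
    rewrite E at 2. now rewrite !eta_vcs_eps, Ev. }
  destruct e, e'; simpl in *; subst; f_equal; apply proof_irrelevance.
Qed.

(** Comparisons are described by their property and not by the formula [η'|ε], so that compositors,
    unitors and inverses can be recognised as such. Equality of the two 1v-cells is implied: compare
    left sides in the equation. *)
Definition canon {A B : Ob D} (e e' : Cp A B) (θ : Sq D) : Prop :=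
  isSq θ (arr e) (arr e') (vid A) (vid B) /\ θ ⫽ eps e' = eps e.

Lemma canon_unique {A B : Ob D} (e e' : Cp A B) (θ φ : Sq D) :
  canon e e' θ -> canon e e' φ -> θ = φ.
Proof.
  intros [H1 E1] [H2 E2]; hyps.
  apply (@cancel_eps _ _ e'); congruence.
Qed.

(** Above ε' the factor η' turns into η'/ε' = Id^u, and Id^u beside ε is ε. *)
Lemma canon_comparison {A B : Ob D} (e e' : Cp A B) :
  vert e = vert e' -> canon e e' (eta e' ∥ eps e).
Proof.
  intros E. split; [bd|].
  transitivity ((eta e' ∥ eps e) ⫽ (eps e' ∥ sqH (hid B))).
  { now rewrite hcs_hid by bd. }
  rewrite (interchange HD), eta_vcs_eps, vcs_sqH by bd.
  now rewrite sqV_hcs by bd.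
Qed.

Lemma canon_sqH {A B : Ob D} (e : Cp A B) : canon e e (sqH (arr e)).
Proof. split; [bd|]. now rewrite sqH_vcs by bd. Qed.

(** The two middle companions may be written differently, typically with another bracketing; their
    equality becomes a side condition. *)
Lemma canon_vcs {A B : Ob D} (e1 e2 e2' e3 : Cp A B) (θ φ : Sq D) :
  canon e1 e2 θ -> canon e2' e3 φ -> e2 = e2' -> canon e1 e3 (θ ⫽ φ).
Proof.
  intros [H1 E1] [H2 E2] <-; hyps. split; [bd|].
  now rewrite (vcs_assoc HD), E2, E1 by bd.
Qed.

Lemma canon_vinverse {A B : Ob D} (e e' : Cp A B) (θ φ : Sq D) :
  canon e e' θ -> vinverse θ φ -> canon e' e φ.
Proof.
  intros [(Ht & Hb & Hl & Hr) E] (H1 & H2 & H3 & H4).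
  assert (top φ = arr e') by congruence.
  assert (bot φ = arr e) by congruence.
  clear H1 H2.
  assert (vsrc (lft φ) = A) by (rewrite <- (sq_nw HD); bd).
  assert (vsrc (rgt φ) = B) by (rewrite <- (sq_ne HD); bd).
  assert (lft φ = vid A).
  { transitivity (lft (θ ⫽ φ)); [bd|rewrite H3; bd]. }
  assert (rgt φ = vid B).
  { transitivity (rgt (θ ⫽ φ)); [bd|rewrite H3; bd]. }
  split; [bd|].
  rewrite <- E, <- (vcs_assoc HD), H4 by bd.
  now rewrite sqH_vcs by bd.
Qed.

Lemma vinverse_canon {A B : Ob D} (e e' : Cp A B) (θ φ : Sq D) :
  canon e e' θ -> canon e' e φ -> vinverse θ φ.
Proof.
  intros Hθ Hφ.
  pose proof (canon_unique (canon_vcs Hθ Hφ eq_refl) (canon_sqH e)).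
  pose proof (canon_unique (canon_vcs Hφ Hθ eq_refl) (canon_sqH e')).
  destruct Hθ, Hφ; hyps; unfold vinverse; bd.
Qed.

Lemma canon_vinvertible {A B : Ob D} (e e' : Cp A B) (θ : Sq D) :
  canon e e' θ -> vinvertible θ.
Proof.
  intros Hθ. assert (E : vert e' = vert e).
  { destruct Hθ as [H E]; hyps. rewrite <- (lft_eps e), <- E. bd. }
  exists (eta e ∥ eps e').
  apply (vinverse_canon Hθ), canon_comparison, E.
Qed.

Lemma is_companion_one (A : Ob D) :
  is_companion (vid A) (hid A) (sqH (hid A)) (sqH (hid A)).
Proof.
  split; try bd.
  - now rewrite hcs_hid by bd.
  - rewrite sqH_vcs by bd. apply (sqH_hid HD).
Qed.

Definition one_cp (A : Ob D) : Cp A A := MkCp (vid_bd HD A) (is_companion_one A).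

(** The two squares touch only at the object [A]. As in the Eckmann-Hilton argument, both are padded
    with the identity square of [A] and interchanged. *)
Lemma hcs_eq_vcs (A : Ob D) (a b : Sq D) :
  rgt a = vid A -> bot a = hid A -> lft b = vid A -> top b = hid A ->
  a ∥ b = a ⫽ b.
Proof.
  intros. transitivity ((a ⫽ sqH (hid A)) ∥ (sqH (hid A) ⫽ b)).
  { now rewrite vcs_sqH, sqH_vcs. }
  rewrite <- (interchange HD), hcs_hid, hid_hcs by bd. reflexivity.
Qed.

Lemma isV_star {A B C : Ob D} (e : Cp A B) (f : Cp B C) :
  isV (vcomp (vert e) (vert f)) A C.
Proof. bd. Qed.

Lemma is_companion_star {A B C : Ob D} (e : Cp A B) (f : Cp B C) :
  is_companion (vcomp (vert e) (vert f)) (arr e ⋅ arr f)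
    ((eps e ∥ sqH (arr f)) ⫽ eps f) (eta e ⫽ (sqH (arr e) ∥ eta f)).
Proof.
  assert (E1 : (sqH (arr e) ∥ eta f) ⫽ (eps e ∥ sqH (arr f)) = eps e ∥ eta f).
  { rewrite (interchange HD), sqH_vcs, vcs_sqH by bd. reflexivity. }
  split; try bd.
  - rewrite <- (interchange HD), (@hcs_assoc _ HD (sqH (arr e))) by bd.
    rewrite <- (hcs_assoc HD), !eta_eps, <- (sqH_hcomp HD) by bd.
    now rewrite sqH_vcs by bd.
  - rewrite (vcs_assoc HD), <- (@vcs_assoc _ HD (sqH (arr e) ∥ eta f)), E1 by bd.
    rewrite (sqV_vcomp HD), <- eta_vcs_eps, <- eta_vcs_eps by bd.
    (* ε_e and η_f touch only at [B], so [ε_e|η_f] may be stacked, and the column regroups as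
       (η_e/ε_e)/(η_f/ε_f). *)
    rewrite (hcs_eq_vcs (A := B)), !(vcs_assoc HD) by bd. reflexivity.
Qed.

Definition star {A B C : Ob D} (e : Cp A B) (f : Cp B C) : Cp A C :=
  MkCp (isV_star e f) (is_companion_star e f).

(** An equality and not merely an invertible comparison, because 1h-composition is strict and
    [Cp_eq] only looks at [eps]. *)
Lemma star_assoc {A B C E : Ob D} (e : Cp A B) (f : Cp B C) (g : Cp C E) :
  star (star e f) g = star e (star f g).
Proof.
  apply Cp_eq; simpl.
  rewrite (sqH_hcomp HD), <- (hcs_assoc HD), <- (vcs_assoc HD) by bd.
  f_equal. rewrite (interchange HD), vcs_sqH by bd. reflexivity.
Qed.

Lemma star_one_l {A B : Ob D} (e : Cp A B) : star (one_cp A) e = e.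
Proof.
  apply Cp_eq; simpl.
  rewrite hid_hcs by bd. apply sqH_vcs. bd.
Qed.

Lemma canon_hcs {A B C : Ob D} (e e' : Cp A B) (f f' : Cp B C) (θ φ : Sq D) :
  canon e e' θ -> canon f f' φ -> canon (star e f) (star e' f') (θ ∥ φ).
Proof.
  intros [H1 E1] [H2 E2]; hyps. split; simpl; [bd|].
  rewrite <- (vcs_assoc HD), (interchange HD), E1 by bd.
  rewrite vcs_sqH by bd.
  (* φ slides below ε_e, whose bottom is the identity of [B], and is then absorbed by the [eps] of
     [f']. *)
  transitivity (((eps e ∥ sqH (arr f)) ⫽ (sqH (hid B) ∥ φ)) ⫽ eps f').
  { now rewrite (interchange HD), vcs_sqH, sqH_vcs by bd. }
  rewrite hid_hcs, (vcs_assoc HD), E2 by bd. reflexivity.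
Qed.

End Companions.

(** * Pseudodouble functors *)

Section FunctorInverses.
Context {D E : dbl} {HD : is_dbl D} {HE : is_dbl E} (F : pdf D E) {HF : is_pdf F}.

Lemma fci_fc f g : htgt f = hsrc g -> fci F f g ⫽ fc F f g = sqH (fH F (f ⋅ g)).
Proof. intros fg. destruct (fc_inv HF fg) as (_ & _ & _ & ->). now rewrite bot_fc. Qed.
Lemma fu_fui A : fu F A ⫽ fui F A = sqH (hid (fO F A)).
Proof. destruct (fu_inv HF A) as (_ & _ & -> & _). now rewrite top_fu. Qed.
Lemma fui_fu A : fui F A ⫽ fu F A = sqH (fH F (hid A)).
Proof. destruct (fu_inv HF A) as (_ & _ & _ & ->). now rewrite bot_fu. Qed.

Lemma fui_nat u : fS F (sqV u) ⫽ fui F (vtgt u) = fui F (vsrc u) ⫽ sqV (fV F u).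
Proof.
  rewrite <- (@sqH_vcs _ _ (fH F (hid (vsrc u))) (fS F (sqV u))) by bd.
  rewrite <- fui_fu, !(vcs_assoc HE) by bd. f_equal.
  rewrite <- (vcs_assoc HE), <- (fu_nat HF), (vcs_assoc HE), fu_fui by bd.
  apply vcs_sqH. bd.
Qed.

(** The left unit law solved for the compositor. It trades the inverse unitor in the [eps] of an
    image companion for a compositor, to which naturality applies. *)
Lemma fui_hcs_sqH f A : hsrc f = A -> fui F A ∥ sqH (fH F f) = fc F (hid A) f.
Proof.
  intros <-.
  rewrite <- (@vcs_sqH _ _ (fH F f) (fui F _ ∥ _)) by bd.
  rewrite <- (fc_unit_l HF f) at 2.
  rewrite <- (vcs_assoc HE), (interchange HE), fui_fu by bd.
  rewrite vcs_sqH, <- (sqH_hcomp HE), sqH_vcs by bd. reflexivity.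
Qed.

Lemma sqH_hcs_fui f A : htgt f = A -> sqH (fH F f) ∥ fui F A = fc F f (hid A).
Proof.
  intros <-.
  rewrite <- (@vcs_sqH _ _ (fH F f) (_ ∥ fui F _)) by bd.
  rewrite <- (fc_unit_r HF f) at 2.
  rewrite <- (vcs_assoc HE), (interchange HE), fui_fu by bd.
  rewrite vcs_sqH, <- (sqH_hcomp HE), sqH_vcs by bd. reflexivity.
Qed.

End FunctorInverses.

(** * Products, strict functors and composites *)

#[export] Instance is_dbl_dprod {D E : dbl} {HD : is_dbl D} {HE : is_dbl E} : is_dbl (D × E).
Proof.
  split; unfold isH, isV, isSq; simpl; intros; repeat match goal with
    | x : _ * _ |- _ => destruct x | H : (_, _) = (_, _) |- _ => injection H as ? ? end;
    simpl in *;
    repeat match goal with |- _ /\ _ => split end;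
    f_equal; bdn; auto using sq_nw, sq_ne, sq_sw, sq_se, hcomp_assoc, vcomp_assoc,
      hcs_assoc, vcs_assoc, interchange, sqH_hid, sqH_hcomp, sqV_vcomp,
      hcomp_1l, hcomp_1r, vcomp_1l, vcomp_1r, hcs_1l, hcs_1r, vcs_1l, vcs_1r.
Qed.

#[export] Instance is_dbl_dunit : is_dbl dunit.
Proof.
  split; unfold isH, isV, isSq; simpl; intros;
    repeat match goal with x : unit |- _ => destruct x end; auto.
Qed.

(** The hypotheses on composites carry no composability conditions: the reindexings to which this is
    applied preserve even the junk values, so every hypothesis holds by computation. *)
Lemma is_pdf_strict {D E : dbl} {HD : is_dbl D} {HE : is_dbl E} (o : Ob D -> Ob E) h v s :
  (forall f, isH (h f) (o (hsrc f)) (o (htgt f))) ->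
  (forall u, isV (v u) (o (vsrc u)) (o (vtgt u))) ->
  (forall a, isSq (s a) (h (top a)) (h (bot a)) (v (lft a)) (v (rgt a))) ->
  (forall A, v (vid A) = vid (o A)) ->
  (forall u w, v (vcomp u w) = vcomp (v u) (v w)) ->
  (forall f, s (sqH f) = sqH (h f)) ->
  (forall a b, s (a ⫽ b) = s a ⫽ s b) ->
  (forall A, h (hid A) = hid (o A)) ->
  (forall f g, h (f ⋅ g) = h f ⋅ h g) ->
  (forall u, s (sqV u) = sqV (v u)) ->
  (forall a b, s (a ∥ b) = s a ∥ s b) ->
  is_pdf (strict o h v s).
Proof.
  intros Hh Hv Hs Hvi Hvc HsH Hsv Hhi Hhc HsV Hsh.
  assert (Hh1 : forall f, hsrc (h f) = o (hsrc f)) by apply Hh.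
  assert (Hh2 : forall f, htgt (h f) = o (htgt f)) by apply Hh.
  assert (Hv1 : forall f, vsrc (v f) = o (vsrc f)) by apply Hv.
  assert (Hv2 : forall f, vtgt (v f) = o (vtgt f)) by apply Hv.
  assert (Hs1 : forall a, top (s a) = h (top a)) by apply Hs.
  assert (Hs2 : forall a, bot (s a) = h (bot a)) by apply Hs.
  assert (Hs3 : forall a, lft (s a) = v (lft a)) by apply Hs.
  assert (Hs4 : forall a, rgt (s a) = v (rgt a)) by apply Hs.
  split; simpl; intros; auto.
  - unfold glob. rewrite Hhc. bd.
  - unfold vinverse. bdn. rewrite !sqH_vcs by bd. auto.
  - now rewrite !Hhc, Hsh, vcs_sqH, sqH_vcs by bd.
  - rewrite Hhi. bd.
  - unfold vinverse. bdn. rewrite !sqH_vcs by bd. auto.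
  - now rewrite HsV, !Hhi, vcs_sqH, sqH_vcs by bd.
  - rewrite !Hhc, <- !(sqH_hcomp HE), (hcomp_assoc HE) by bd. reflexivity.
  - rewrite Hhc, !Hhi, hid_hcs, hcomp_hid_l, sqH_vcs by bd. reflexivity.
  - rewrite Hhc, !Hhi, hcs_hid, hcomp_hid_r, sqH_vcs by bd. reflexivity.
Qed.

#[export] Instance is_pdf_fid {D : dbl} {HD : is_dbl D} : is_pdf (fid D).
Proof.
  apply (is_pdf_strict (o := fun A => A) (h := fun f => f) (v := fun u => u) (s := fun a => a));
    repeat split.
Qed.

#[export] Instance is_pdf_fassoc {C D E : dbl} {HC : is_dbl C} {HD : is_dbl D} {HE : is_dbl E} :
  is_pdf (fassoc C D E).
Proof. apply is_pdf_strict; repeat split. Qed.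

#[export] Instance is_pdf_funitl {D : dbl} {HD : is_dbl D} : is_pdf (funitl D).
Proof. apply is_pdf_strict; repeat split. Qed.

#[export] Instance is_pdf_funitr {D : dbl} {HD : is_dbl D} : is_pdf (funitr D).
Proof. apply is_pdf_strict; repeat split. Qed.

#[export] Instance is_pdf_fprod {C D C' D' : dbl} {F : pdf C D} {G : pdf C' D'}
  {HF : is_pdf F} {HG : is_pdf G} : is_pdf (fprod F G).
Proof.
  split; unfold vinverse, glob, isH, isV, isSq; simpl; intros; repeat match goal with
    | x : _ * _ |- _ => destruct x | H : (_, _) = (_, _) |- _ => injection H as ? ? end;
    simpl in *.
  - destruct (fH_bd HF h), (fH_bd HG h0); split; f_equal; auto.
  - destruct (fV_bd HF v), (fV_bd HG v0); split; f_equal; auto.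
  - destruct (fS_bd HF s) as (?&?&?&?), (fS_bd HG s0) as (?&?&?&?); repeat split; f_equal; auto.
  - f_equal; apply fV_vid; assumption.
  - f_equal; apply fV_vcomp; assumption.
  - f_equal; apply fS_sqH; assumption.
  - f_equal; apply fS_vcs; assumption.
  - destruct (fc_bd HF (f:=h1) (g:=h)) as (?&?&?&?), (fc_bd HG (f:=h2) (g:=h0)) as (?&?&?&?); auto;
      repeat split; f_equal; auto.
  - destruct (fc_inv HF (f:=h1) (g:=h)) as (?&?&?&?), (fc_inv HG (f:=h2) (g:=h0)) as (?&?&?&?); auto;
      repeat split; f_equal; auto.
  - f_equal; apply fc_nat; assumption.
  - destruct (fu_bd HF o) as (?&?&?&?), (fu_bd HG o0) as (?&?&?&?); repeat split; f_equal; auto.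
  - destruct (fu_inv HF o) as (?&?&?&?), (fu_inv HG o0) as (?&?&?&?); repeat split; f_equal; auto.
  - f_equal; apply fu_nat; assumption.
  - f_equal; apply fc_assoc; assumption.
  - f_equal; apply fc_unit_l; assumption.
  - f_equal; apply fc_unit_r; assumption.
Qed.

Section FunctorComposite.
Context {C D E : dbl} {HC : is_dbl C} {HD : is_dbl D} {HE : is_dbl E}.
Context {G : pdf D E} {F : pdf C D} {HG : is_pdf G} {HF : is_pdf F}.

(** Common core of associativity and the left unit law for a composite: [a] is a compositor or
    unitor of [F], and [x] the matching one of [G]. Naturality of the compositor of [G] moves G(a)
    past it, which separates the law of [G] from that of [F]. *)
Lemma fcomp_paste_l (a b : Sq D) (k : Hc D) (x : Sq E) :
  bot x = fH G (top a) -> lft a = vid (hsrc (top a)) -> rgt a = vid (hsrc k) ->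
  rgt x = vid (fO G (hsrc k)) -> top b = bot a ⋅ k ->
  ((x ⫽ fS G a) ∥ sqH (fH G k)) ⫽ (fc G (bot a) k ⫽ fS G b) =
  (x ∥ sqH (fH G k)) ⫽ fc G (top a) k ⫽ fS G ((a ∥ sqH k) ⫽ b).
Proof.
  intros Hx Hl Hr Hxr Hb.
  assert (htgt (bot a) = hsrc k) by (rewrite (sq_se HD), Hr; bd).
  assert (htgt (top a) = hsrc k) by (rewrite (sq_ne HD), Hr; bd).
  pose proof (fc_nat HG (a := a) (b := sqH k) ltac:(bd)) as N.
  rewrite (fS_sqH HG), top_sqH, bot_sqH in N.
  rewrite (fS_vcs HG), <- !(vcs_assoc HE) by bd. f_equal.
  rewrite (vcs_assoc HE), <- N, <- (vcs_assoc HE), (interchange HE) by bd.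
  now rewrite vcs_sqH by bd.
Qed.

Lemma fcomp_paste_r (a b : Sq D) (k : Hc D) (x : Sq E) :
  bot x = fH G (top a) -> rgt a = vid (htgt (top a)) -> lft a = vid (htgt k) ->
  lft x = vid (fO G (htgt k)) -> top b = k ⋅ bot a ->
  (sqH (fH G k) ∥ (x ⫽ fS G a)) ⫽ (fc G k (bot a) ⫽ fS G b) =
  (sqH (fH G k) ∥ x) ⫽ fc G k (top a) ⫽ fS G ((sqH k ∥ a) ⫽ b).
Proof.
  intros Hx Hl Hr Hxr Hb.
  assert (hsrc (bot a) = htgt k) by (rewrite (sq_sw HD), Hr; bd).
  assert (hsrc (top a) = htgt k) by (rewrite (sq_nw HD), Hr; bd).
  pose proof (fc_nat HG (a := sqH k) (b := a) ltac:(bd)) as N.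
  rewrite (fS_sqH HG), top_sqH, bot_sqH in N.
  rewrite (fS_vcs HG), <- !(vcs_assoc HE) by bd. f_equal.
  rewrite (vcs_assoc HE), <- N, <- (vcs_assoc HE), (interchange HE) by bd.
  now rewrite vcs_sqH by bd.
Qed.

Lemma vinverse_fcomp (x x' : Sq E) (a a' : Sq D) :
  bot x = fH G (top a) -> vinverse x x' -> vinverse a a' ->
  vinverse (x ⫽ fS G a) (fS G a' ⫽ x').
Proof.
  intros Hx (X1 & X2 & X3 & X4) (A1 & A2 & A3 & A4).
  assert (top x' = fH G (top a)) by congruence.
  assert (top a' = bot a) by congruence.
  clear X1 A1. unfold vinverse. bdn. repeat split; try congruence.
  - rewrite (vcs_assoc HE), <- (@vcs_assoc _ HE (fS G a)), <- (fS_vcs HG), A3 by bd.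
    rewrite (fS_sqH HG), sqH_vcs by bd. assumption.
  - rewrite (vcs_assoc HE), <- (@vcs_assoc _ HE x'), X4, sqH_vcs by bd.
    rewrite <- (fS_vcs HG), A4, (fS_sqH HG) by bd. reflexivity.
Qed.

#[export] Instance is_pdf_fcomp : is_pdf (fcomp G F).
Proof.
  split; simpl; intros.
  - bd.
  - bd.
  - bd.
  - bd.
  - rewrite (fV_vcomp HF), (fV_vcomp HG) by bd. reflexivity.
  - now rewrite (fS_sqH HF), (fS_sqH HG).
  - rewrite (fS_vcs HF), (fS_vcs HG) by bd. reflexivity.
  - bd.
  - apply vinverse_fcomp; [bd|apply (fc_inv HG)|apply (fc_inv HF)]; bd.
  - assert (htgt (top a) = hsrc (top b)) by (rewrite (sq_ne HC), (sq_nw HC); bd).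
    assert (htgt (bot a) = hsrc (bot b)) by (rewrite (sq_se HC), (sq_sw HC); bd).
    pose proof (fc_nat HG (a := fS F a) (b := fS F b) ltac:(bd)) as N.
    rewrite !(top_fS (F:=F)), !(bot_fS (F:=F)) in N.
    rewrite <- (vcs_assoc HE), N, !(vcs_assoc HE), <- !(fS_vcs HG), (fc_nat HF) by bd.
    reflexivity.
  - bd.
  - apply vinverse_fcomp; [bd|apply (fu_inv HG)|apply (fu_inv HF)].
  - pose proof (fu_nat HG (fV F u)) as N.
    rewrite (vsrc_fV (F:=F)), (vtgt_fV (F:=F)) in N.
    rewrite <- (vcs_assoc HE), N, !(vcs_assoc HE), <- !(fS_vcs HG), (fu_nat HF) by bd.
    reflexivity.
  - pose proof (fcomp_paste_l (a := fc F f g) (b := fc F (f ⋅ g) h) (k := fH F h) (x := fc G (fH F f) (fH F g))) as L.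
    pose proof (fcomp_paste_r (a := fc F g h) (b := fc F f (g ⋅ h)) (k := fH F f) (x := fc G (fH F g) (fH F h))) as R.
    rewrite !(bot_fc (F:=F)), !(top_fc (F:=F)) in L, R by bd.
    rewrite L, R by bd.
    now rewrite (fc_assoc HG), (fc_assoc HF) by bd.
  - pose proof (fcomp_paste_l (a := fu F (hsrc f)) (b := fc F (hid (hsrc f)) f) (k := fH F f) (x := fu G (fO F (hsrc f)))) as L.
    rewrite (bot_fu (F:=F)), (top_fu (F:=F)) in L. rewrite L by bd.
    pose proof (fc_unit_l HG (fH F f)) as U. rewrite (hsrc_fH (F:=F)) in U.
    rewrite U, (fc_unit_l HF), (fS_sqH HG). apply sqH_vcs. bd.
  - pose proof (fcomp_paste_r (a := fu F (htgt f)) (b := fc F f (hid (htgt f))) (k := fH F f) (x := fu G (fO F (htgt f)))) as R.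
    rewrite (bot_fu (F:=F)), (top_fu (F:=F)) in R. rewrite R by bd.
    pose proof (fc_unit_r HG (fH F f)) as U. rewrite (htgt_fH (F:=F)) in U.
    rewrite U, (fc_unit_r HF), (fS_sqH HG). apply sqH_vcs. bd.
Qed.
End FunctorComposite.

(** * Images of companions *)

Section FunctorCompanions.
Context {D E : dbl} {HD : is_dbl D} {HE : is_dbl E} (F : pdf D E) {HF : is_pdf F}.

Lemma isV_map {A B : Ob D} (e : Cp A B) : isV (fV F (vert e)) (fO F A) (fO F B).
Proof. bd. Qed.

(** F(ε) ends at F(id_B) and F(η) starts at F(id_A); the unitors restore the identity boundaries. *)
Lemma is_companion_map {A B : Ob D} (e : Cp A B) :
  is_companion (fV F (vert e)) (fH F (arr e))
    (fS F (eps e) ⫽ fui F B) (fu F A ⫽ fS F (eta e)).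
Proof.
  split; try bd.
  - transitivity ((fu F A ∥ sqH (fH F (arr e)))
      ⫽ ((fS F (eta e) ∥ fS F (eps e)) ⫽ (sqH (fH F (arr e)) ∥ fui F B))).
    { rewrite (interchange HE), (interchange HE), vcs_sqH, sqH_vcs by bd. reflexivity. }
    (* Once the inverse unitor is read as a compositor, naturality at the pair (η, ε) reduces the
       equation to the left unit law. *)
    rewrite sqH_hcs_fui by bd.
    pose proof (fc_nat HF (a := eta e) (b := eps e) ltac:(bd)) as N.
    rewrite bot_eta, bot_eps, top_eta, top_eps, eta_eps, (fS_sqH HF) in N.
    rewrite N, <- (vcs_assoc HE) by bd.
    pose proof (fc_unit_l HF (arr e)) as U. rewrite hsrc_arr in U.
    rewrite U. apply sqH_vcs. bd.
  - rewrite (vcs_assoc HE), <- (@vcs_assoc _ HE (fS F (eta e))), <- (fS_vcs HF) by bd.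
    pose proof (fui_nat (F := F) (vert e)) as N.
    rewrite vsrc_vert, vtgt_vert in N.
    rewrite eta_vcs_eps, N, <- (vcs_assoc HE), fu_fui by bd. apply sqH_vcs. bd.
Qed.

Definition map_cp {A B : Ob D} (e : Cp A B) : Cp (fO F A) (fO F B) :=
  MkCp (isV_map e) (is_companion_map e).

Lemma canon_map {A B : Ob D} (e e' : Cp A B) (θ : Sq D) :
  canon e e' θ -> canon (map_cp e) (map_cp e') (fS F θ).
Proof.
  intros [H1 E1]; hyps. split; simpl; [bd|].
  rewrite <- (vcs_assoc HE), <- (fS_vcs HF), E1 by bd. reflexivity.
Qed.

(** This is naturality of the compositor at the pair (ε_e, Id_f), once the whiskered inverse unitor
    is read as a compositor. *)
Lemma canon_fc {A B C : Ob D} (e : Cp A B) (f : Cp B C) :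
  canon (star (map_cp e) (map_cp f)) (map_cp (star e f)) (fc F (arr e) (arr f)).
Proof.
  split; simpl; [bd|].
  pose proof (fc_nat HF (a := eps e) (b := sqH (arr f)) ltac:(bd)) as N.
  rewrite bot_eps, top_eps, bot_sqH, top_sqH, (fS_sqH HF) in N.
  rewrite (fS_vcs HF), <- !(vcs_assoc HE), <- N by bd. do 2 f_equal.
  rewrite <- (fui_hcs_sqH (F := F)), (interchange HE) by bd.
  now rewrite vcs_sqH by bd.
Qed.

Lemma canon_fci {A B C : Ob D} (e : Cp A B) (f : Cp B C) :
  canon (map_cp (star e f)) (star (map_cp e) (map_cp f)) (fci F (arr e) (arr f)).
Proof. apply (canon_vinverse (canon_fc e f)), (fc_inv HF). bd. Qed.

Lemma canon_fu (A : Ob D) : canon (one_cp (fO F A)) (map_cp (one_cp A)) (fu F A).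
Proof.
  split; simpl; [bd|].
  rewrite (fS_sqH HF), sqH_vcs, fu_fui by bd. reflexivity.
Qed.

Lemma canon_fui (A : Ob D) : canon (map_cp (one_cp A)) (one_cp (fO F A)) (fui F A).
Proof. apply (canon_vinverse (canon_fu A)), (fu_inv HF). Qed.

End FunctorCompanions.
Arguments map_cp {D E HD HE} F {HF A B} e.

Section PairedCompanions.
Context {D E : dbl} {HD : is_dbl D} {HE : is_dbl E}.

Section Pair.
Context {A B : Ob D} {A' B' : Ob E} (e : Cp A B) (e' : Cp A' B').

Lemma isV_pair : @isV (D × E) (vert e, vert e') (A, A') (B, B').
Proof. split; simpl; f_equal; bd. Qed.

Lemma is_companion_pair :
  @is_companion (D × E) (vert e, vert e') (arr e, arr e') (eps e, eps e') (eta e, eta e').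
Proof.
  destruct e as [? ? ? ? ? [[] (?&?&?&?) (?&?&?&?) ? ?]].
  destruct e' as [? ? ? ? ? [[] (?&?&?&?) (?&?&?&?) ? ?]].
  split; repeat split; simpl; f_equal; assumption.
Qed.

Definition pair_cp : @Cp (D × E) (A, A') (B, B') := MkCp isV_pair is_companion_pair.
End Pair.

Lemma canon_pair {A B : Ob D} {A' B' : Ob E} (e f : Cp A B) (e' f' : Cp A' B') θ θ' :
  canon e f θ -> canon e' f' θ' -> canon (pair_cp e e') (pair_cp f f') (θ, θ').
Proof.
  intros [(?&?&?&?) ?] [(?&?&?&?) ?].
  repeat split; simpl; f_equal; assumption.
Qed.

End PairedCompanions.

(** * Companion-lifts *)

Section Lifts.
Context {D E : dbl} {HD : is_dbl D} {HE : is_dbl E}.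

(* [h] behaves like the companion-lift of [s] along the companions [e]; unlike
   [companion_lift], this is stable under composition and whiskering. *)
Record is_lift (F G : pdf D E) (s : vtr D E) (h : htr D E)
    (e : forall A, Cp (fO F A) (fO G A)) : Prop := {
  lift_vert : forall A, vert (e A) = vO s A;
  lift_arr : forall A, hO h A = arr (e A);
  lift_H : forall f, isSq (vH s f) (fH F f) (fH G f) (vert (e (hsrc f))) (vert (e (htgt f)));
  lift_δ_bd : forall f, isSq (hδ h f)
    (fH F f ⋅ arr (e (htgt f))) (arr (e (hsrc f)) ⋅ fH G f)
    (vid (fO F (hsrc f))) (vid (fO G (htgt f)));
  lift_V_bd : forall u, isSq (hV h u) (arr (e (vsrc u))) (arr (e (vtgt u))) (fV F u) (fV G u);
  lift_δ : forall f,
    hδ h f ⫽ (eps (e (hsrc f)) ∥ sqH (fH G f)) = vH s f ∥ eps (e (htgt f));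
  lift_V : forall u, hV h u ⫽ eps (e (vtgt u)) = eps (e (vsrc u)) ⫽ sqV (fV G u)
}.

Context (F G : pdf D E) {HF : is_pdf F} {HG : is_pdf G}.

(** Pasted with the [eps] of [e'], both sides of the condition on [δ] become [s_f|ε] and both sides
    of the condition on 1v-cells become ε/Id^{G(u)}, where ε belongs to [e]. *)
Lemma comparison_modification (s s' : vtr D E) (h h' : htr D E) (e e' : forall A, Cp (fO F A) (fO G A)) :
  is_lift s h e -> is_lift s' h' e' -> vtr_eq s s' ->
  exists m, is_inv_modification F G h h' m /\ forall A, canon (e A) (e' A) (m A).
Proof.
  intros L L' [EV Ess].
  pose (m := fun A => eta (e' A) ∥ eps (e A)).
  assert (Hm : forall A, canon (e A) (e' A) (m A)).
  { intros A. apply canon_comparison. now rewrite (lift_vert L), (lift_vert L'). }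
  exists m. split; [|exact Hm]. clearbody m.
  split.
  - intros A. destruct (Hm A) as [? _]. rewrite (lift_arr L), (lift_arr L'). hyps. bd.
  - intros A. exact (canon_vinvertible (Hm A)).
  - intros f.
    destruct (Hm (hsrc f)) as [? E1], (Hm (htgt f)) as [? E2].
    pose proof (lift_δ_bd L f). pose proof (lift_δ_bd L' f).
    pose proof (lift_H L f). pose proof (lift_H L' f). hyps.
    apply (@cancel_eps_hcs _ _ _ _ (e' (hsrc f)) (fH G f)); try bd.
    rewrite !(vcs_assoc HE), (lift_δ L'), (interchange HE), E2 by bd.
    rewrite (interchange HE), E1, vcs_sqH, (lift_δ L), sqH_vcs by bd.
    now rewrite Ess.
  - intros u.
    destruct (Hm (vsrc u)) as [? E1], (Hm (vtgt u)) as [? E2].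
    pose proof (lift_V_bd L u). pose proof (lift_V_bd L' u). hyps.
    apply (cancel_eps (e := e' (vtgt u))); try bd.
    rewrite !(vcs_assoc HE), (lift_V L'), E2, (lift_V L), <- (vcs_assoc HE), E1 by bd.
    reflexivity.
Qed.

(* Both composites are companions of the 1v-cell in the naturality square of [s]. *)
Lemma canon_lift_δ (s : vtr D E) (h : htr D E) (e : forall A, Cp (fO F A) (fO G A)) :
  is_lift s h e -> is_vtr F G s -> forall (A B : Ob D) (c : Cp A B),
  canon (star (map_cp F c) (e B)) (star (e A) (map_cp G c)) (hδ h (arr c)).
Proof.
  intros L N A B c.
  pose proof (lift_δ_bd L (arr c)). pose proof (lift_δ L (arr c)) as Ed.
  pose proof (lift_H L (arr c)). pose proof (lift_H L (hid B)).
  rewrite hsrc_arr, htgt_arr in *. rewrite hsrc_hid, htgt_hid in *. hyps.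
  split; simpl; [bd|].
  rewrite <- (vcs_assoc HE), Ed by bd.
  transitivity ((vH s (arr c) ∥ eps (e B)) ⫽ ((fS G (eps c) ⫽ fui G B) ∥ sqH (hid (fO G B)))).
  { now rewrite hcs_hid by bd. }
  rewrite (interchange HE), vcs_sqH by bd.
  pose proof (vH_nat N (eps c)) as Nc. rewrite top_eps, bot_eps in Nc.
  pose proof (vH_fu N B) as Nu. rewrite <- (lift_vert L) in Nu.
  (* Compatibility of [s] with the unitors, solved for their inverses. Together with naturality at
     ε_c it turns the [eps] of the image under [G] into that of the image under [F]. *)
  assert (Nu' : vH s (hid B) ⫽ fui G B = fui F B ⫽ sqV (vert (e B))).
  { rewrite <- (@sqH_vcs _ _ (fH F (hid B)) (vH s (hid B))) by bd.
    rewrite <- fui_fu, (@vcs_assoc _ HE (fui F B)), <- Nu by bd.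
    rewrite !(vcs_assoc HE), fu_fui by bd. f_equal. apply vcs_sqH. bd. }
  rewrite <- (vcs_assoc HE), <- Nc, (vcs_assoc HE), Nu', <- (vcs_assoc HE) by bd.
  transitivity (((fS F (eps c) ⫽ fui F B) ⫽ sqV (vert (e B))) ∥ (sqH (arr (e B)) ⫽ eps (e B))).
  { now rewrite sqH_vcs by bd. }
  rewrite <- (interchange HE), sqV_hcs by bd. reflexivity.
Qed.

End Lifts.

Lemma is_lift_id {D E : dbl} {HD : is_dbl D} {HE : is_dbl E} (F : pdf D E) {HF : is_pdf F} :
  is_lift (F := F) (G := F) (vtr_id F) (htr_id F) (fun A => one_cp (fO F A)).
Proof.
  split; simpl; intros; try bd; try reflexivity.
  - rewrite hid_hcs, hcs_hid by bd. apply vcs_sqH. bd.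
  - rewrite vcs_sqH, sqH_vcs by bd. reflexivity.
Qed.

(** The [eps] of a composite is [ε|Id]/ε', and the ε in it ends at an identity. The cell [δ] of [k]
    can therefore slide below ε, after which the equations of the two factors apply one after the
    other. *)
Lemma is_lift_comp {D E : dbl} {HD : is_dbl D} {HE : is_dbl E} (F G H : pdf D E)
    {HF : is_pdf F} {HG : is_pdf G} {HH : is_pdf H} s t h k
    (e : forall A, Cp (fO F A) (fO G A)) (e' : forall A, Cp (fO G A) (fO H A)) :
  is_lift s h e -> is_lift t k e' ->
  is_lift (F := F) (G := H) (vtr_comp s t) (htr_comp h k) (fun A => star (e A) (e' A)).
Proof.
  intros L M. split; simpl.
  - intros A. now rewrite (lift_vert L), (lift_vert M).
  - intros A. now rewrite (lift_arr L), (lift_arr M).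
  - intros f. pose proof (lift_H L f). pose proof (lift_H M f). hyps. bd.
  - intros f. pose proof (lift_δ_bd L f). pose proof (lift_δ_bd M f). hyps.
    rewrite (lift_arr L), (lift_arr M). bd.
  - intros u. pose proof (lift_V_bd L u). pose proof (lift_V_bd M u). hyps. bd.
  - intros f. pose proof (lift_δ_bd L f). pose proof (lift_δ_bd M f).
    pose proof (lift_H L f). pose proof (lift_H M f).
    pose proof (lift_δ L f) as EL. pose proof (lift_δ M f) as EM. hyps.
    rewrite (lift_arr L), (lift_arr M).
    remember (hsrc f) as A eqn:EA in *. remember (htgt f) as B eqn:EB in *.
    symmetry in EA, EB.
    transitivity (((hδ h f ∥ sqH (arr (e' B))) ⫽ (sqH (arr (e A)) ∥ hδ k f))
      ⫽ ((eps (e A) ∥ (sqH (arr (e' A)) ∥ sqH (fH H f))) ⫽ (eps (e' A) ∥ sqH (fH H f)))).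
    { rewrite <- (hcs_assoc HE), (@interchange _ HE (eps (e A) ∥ sqH (arr (e' A)))) , sqH_vcs by bd. reflexivity. }
    rewrite (vcs_assoc HE), <- (@vcs_assoc _ HE (sqH (arr (e A)) ∥ hδ k f)) by bd.
    rewrite <- (sqH_hcomp HE), (interchange HE), sqH_vcs, vcs_sqH by bd.
    transitivity ((hδ h f ∥ sqH (arr (e' B))) ⫽ (((eps (e A) ∥ sqH (fH G f ⋅ arr (e' B))) ⫽ (sqH (hid (fO G A)) ∥ hδ k f)) ⫽ (eps (e' A) ∥ sqH (fH H f)))).
    { now rewrite (@interchange _ HE (eps (e A)) (sqH _)), vcs_sqH, sqH_vcs by bd. }
    rewrite hid_hcs, (vcs_assoc HE), EM by bd.
    rewrite (sqH_hcomp HE), <- (hcs_assoc HE), <- (vcs_assoc HE), (interchange HE), EL by bd.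
    rewrite vcs_sqH, (hcs_assoc HE), (interchange HE) by bd. reflexivity.
  - intros u. pose proof (lift_V_bd L u). pose proof (lift_V_bd M u).
    pose proof (lift_V L u) as EL. pose proof (lift_V M u) as EM. hyps.
    rewrite <- (vcs_assoc HE), (interchange HE), EL, vcs_sqH by bd.
    transitivity (((eps (e (vsrc u)) ∥ sqH (arr (e' (vsrc u)))) ⫽ (sqV (fV G u) ∥ hV k u)) ⫽ eps (e' (vtgt u))).
    { now rewrite (interchange HE), sqH_vcs by bd. }
    rewrite sqV_hcs, (vcs_assoc HE), EM, (vcs_assoc HE) by bd. reflexivity.
Qed.

Lemma is_lift_prod {C D C' D' : dbl} {HC : is_dbl C} {HD : is_dbl D} {HC' : is_dbl C'} {HD' : is_dbl D'}
    (F G : pdf C D) (F' G' : pdf C' D') s t h k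
    (e : forall A, Cp (fO F A) (fO G A)) (e' : forall A, Cp (fO F' A) (fO G' A)) :
  is_lift s h e -> is_lift t k e' ->
  is_lift (F := fprod F F') (G := fprod G G') (vtr_prod s t) (htr_prod h k)
    (fun A => pair_cp (e (fst A)) (e' (snd A))).
Proof.
  intros L M. split; simpl; intros x.
  - now rewrite (lift_vert L), (lift_vert M).
  - now rewrite (lift_arr L), (lift_arr M).
  - pose proof (lift_H L (fst x)). pose proof (lift_H M (snd x)). hyps.
    repeat split; simpl; f_equal; assumption.
  - pose proof (lift_δ_bd L (fst x)). pose proof (lift_δ_bd M (snd x)). hyps.
    repeat split; simpl; f_equal; assumption.
  - pose proof (lift_V_bd L (fst x)). pose proof (lift_V_bd M (snd x)). hyps.
    repeat split; simpl; f_equal; assumption.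
  - f_equal; [apply (lift_δ L)|apply (lift_δ M)].
  - f_equal; [apply (lift_V L)|apply (lift_V M)].
Qed.

Lemma is_lift_pre {C D E : dbl} {HC : is_dbl C} {HD : is_dbl D} {HE : is_dbl E}
    (K : pdf C D) {HK : is_pdf K} (F G : pdf D E) s h (e : forall A, Cp (fO F A) (fO G A)) :
  is_lift s h e ->
  is_lift (F := fcomp F K) (G := fcomp G K) (vtr_pre K s) (htr_pre K h) (fun A => e (fO K A)).
Proof.
  intros L. split; simpl; intros x.
  - apply (lift_vert L).
  - apply (lift_arr L).
  - rewrite <- (hsrc_fH (F:=K)), <- (htgt_fH (F:=K)). apply (lift_H L).
  - rewrite <- (hsrc_fH (F:=K)), <- (htgt_fH (F:=K)). apply (lift_δ_bd L).
  - rewrite <- (vsrc_fV (F:=K)), <- (vtgt_fV (F:=K)). apply (lift_V_bd L).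
  - rewrite <- (hsrc_fH (F:=K)), <- (htgt_fH (F:=K)). apply (lift_δ L).
  - rewrite <- (vsrc_fV (F:=K)), <- (vtgt_fV (F:=K)). apply (lift_V L).
Qed.

(** The inverse unitor in the image [eps] is traded for a compositor, which naturality at ε carries
    up to the inverse compositor of [htr_post], where the two cancel. The equation for [h] is then
    applied under [K]. *)
Lemma is_lift_post {C D E : dbl} {HC : is_dbl C} {HD : is_dbl D} {HE : is_dbl E}
    (K : pdf D E) {HK : is_pdf K} (F G : pdf C D) {HF : is_pdf F} {HG : is_pdf G}
    s h (e : forall A, Cp (fO F A) (fO G A)) :
  is_lift s h e ->
  is_lift (F := fcomp K F) (G := fcomp K G) (vtr_post K s) (htr_post K F G h) (fun A => map_cp K (e A)).
Proof.
  intros L. split; simpl.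
  - intros A. now rewrite (lift_vert L).
  - intros A. now rewrite (lift_arr L).
  - intros f. pose proof (lift_H L f). hyps. bd.
  - intros f. pose proof (lift_δ_bd L f). hyps. rewrite !(lift_arr L). bd.
  - intros u. pose proof (lift_V_bd L u). hyps. bd.
  - intros f. pose proof (lift_δ_bd L f). pose proof (lift_H L f). pose proof (lift_δ L f) as EL. hyps.
    rewrite !(lift_arr L).
    remember (hsrc f) as A eqn:EA in *. remember (htgt f) as B eqn:EB in *.
    symmetry in EA, EB.
    transitivity ((fc K (fH F f) (arr (e B)) ⫽ fS K (hδ h f) ⫽ fci K (arr (e A)) (fH G f))
      ⫽ ((fS K (eps (e A)) ∥ sqH (fH K (fH G f))) ⫽ (fui K (fO G A) ∥ sqH (fH K (fH G f))))).
    { now rewrite (interchange HE), sqH_vcs by bd. }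
    pose proof (fc_nat HK (a := eps (e A)) (b := sqH (fH G f)) ltac:(bd)) as N1.
    rewrite top_eps, bot_eps, top_sqH, bot_sqH, (fS_sqH HK) in N1.
    pose proof (fc_nat HK (a := vH s f) (b := eps (e B)) ltac:(bd)) as N2.
    rewrite top_eps, bot_eps in N2.
    rewrite (fui_hcs_sqH (F := K)), N1, (vcs_assoc HE), <- (@vcs_assoc _ HE (fci _ _ _)), fci_fc, sqH_vcs by bd.
    rewrite (vcs_assoc HE), <- (fS_vcs HK), EL by bd.
    transitivity (fc K (top (vH s f)) (arr (e B)) ⫽ fS K (vH s f ∥ eps (e B))).
    { bd. }
    rewrite <- N2, <- (sqH_hcs_fui (F := K)), (interchange HE), vcs_sqH by bd. reflexivity.
  - intros u. pose proof (lift_V_bd L u). pose proof (lift_V L u) as EL. hyps.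
    rewrite <- (vcs_assoc HE), <- (fS_vcs HK), EL, (fS_vcs HK), (vcs_assoc HE) by bd.
    pose proof (fui_nat (F := K) (fV G u)) as N.
    rewrite (vsrc_fV (F:=G)), (vtgt_fV (F:=G)) in N.
    rewrite N, (vcs_assoc HE) by bd. reflexivity.
Qed.

(** * Lifts of invertible transformations as horizontal equivalences *)

Section HorizontalEquivalences.
Context {D E : dbl} {HD : is_dbl D} {HE : is_dbl E}.
Context (F G : pdf D E) {HF : is_pdf F} {HG : is_pdf G}.
Context (s : vtr D E) (h : htr D E) (e : forall A, Cp (fO F A) (fO G A)).
Context (N : is_vtr F G s) (L : is_lift s h e).

(** A further ε below turns η/ε into the identity square of the 1v-cell, which cancels against
    Id^v. *)
Lemma eps_sqV_eta {A B : Ob E} (c : Cp A B) (v : Vc E) :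
  isV v B A -> vcomp (vert c) v = vid A -> vcomp v (vert c) = vid B ->
  eps c ⫽ sqV v ⫽ eta c = sqH (arr c).
Proof.
  intros Hv E1 E2; hyps.
  apply (cancel_eps (e := c)); try bd.
  rewrite !(vcs_assoc HE), eta_vcs_eps, <- (sqV_vcomp HE), E2, <- (sqH_hid HE) by bd.
  rewrite vcs_sqH, sqH_vcs by bd. reflexivity.
Qed.

(** The inverse is [ε/Id^v | b | Id^w/η], where [b] is the inverse of the square s_f and v, w are
    its sides, inverse to the components of [s]. One composite collapses by ε/Id^w/η = Id, the other
    after ε is pasted below. *)
Lemma lift_δ_invertible : vtr_invertible s -> forall f, vinvertible (hδ h f).
Proof.
  intros Inv f. destruct (Inv f) as [b (I1 & I2 & I3 & I4)].
  pose proof (lift_δ_bd L f). pose proof (lift_H L f). pose proof (lift_δ L f) as EL.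
  remember (hsrc f) as A eqn:EA in *. remember (htgt f) as B eqn:EB in *.
  symmetry in EA, EB. hyps.
  assert (top b = fH G f) by congruence.
  assert (bot b = fH F f) by congruence.
  clear I1 I2.
  assert (vsrc (lft b) = fO G A) by (rewrite <- (sq_nw HE); bd).
  assert (vsrc (rgt b) = fO G B) by (rewrite <- (sq_ne HE); bd).
  assert (vtgt (lft b) = fO F A) by (rewrite <- (sq_sw HE); bd).
  assert (vtgt (rgt b) = fO F B) by (rewrite <- (sq_se HE); bd).
  assert (Vl : vcomp (lft b) (vert (e A)) = vid (fO G A)).
  { transitivity (lft (b ⫽ vH s f)); [bd|rewrite I4; bd]. }
  assert (Vr : vcomp (rgt b) (vert (e B)) = vid (fO G B)).
  { transitivity (rgt (b ⫽ vH s f)); [bd|rewrite I4; bd]. }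
  assert (Vr' : vcomp (vert (e B)) (rgt b) = vid (fO F B)).
  { transitivity (rgt (vH s f ⫽ b)); [bd|rewrite I3; bd]. }
  assert (Vl' : vcomp (vert (e A)) (lft b) = vid (fO F A)).
  { transitivity (lft (vH s f ⫽ b)); [bd|rewrite I3; bd]. }
  set (P := eps (e A) ⫽ sqV (lft b)). set (Q := sqV (rgt b) ⫽ eta (e B)).
  assert (top P = arr (e A)) by (unfold P; bd).
  assert (bot P = hid (fO F A)) by (unfold P; bd).
  assert (lft P = vid (fO F A)) by (unfold P; bd).
  assert (rgt P = lft b) by (unfold P; bd).
  assert (top Q = hid (fO G B)) by (unfold Q; bd).
  assert (bot Q = arr (e B)) by (unfold Q; bd).
  assert (lft Q = rgt b) by (unfold Q; bd).
  assert (rgt Q = vid (fO G B)) by (unfold Q; bd).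
  exists ((P ∥ b) ∥ Q). unfold vinverse.
  split; [bd|]. split; [bd|]. split.
  - transitivity (hδ h f ⫽ ((eps (e A) ∥ sqH (fH G f)) ⫽ (sqV (lft b) ∥ (b ∥ Q)))).
    { now rewrite (@interchange _ HE (eps (e A))), sqH_vcs, (hcs_assoc HE) by bd. }
    rewrite <- (vcs_assoc HE), EL, sqV_hcs, (interchange HE), I3 by bd.
    unfold Q. rewrite <- (vcs_assoc HE), eps_sqV_eta by bd.
    rewrite <- (sqH_hcomp HE) by bd. f_equal. bd.
  - apply (@cancel_eps_hcs _ _ _ _ (e A) (fH G f)); try bd.
    rewrite (vcs_assoc HE), EL, (interchange HE) by bd.
    assert (EQ : Q ⫽ eps (e B) = sqH (hid (fO G B))).
    { unfold Q. rewrite (vcs_assoc HE), eta_vcs_eps, <- (sqV_vcomp HE), Vr, (sqH_hid HE) by bd.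
      reflexivity. }
    assert (EP : P ⫽ sqV (vert (e A)) = eps (e A)).
    { unfold P. rewrite (vcs_assoc HE), <- (sqV_vcomp HE), Vl, <- (sqH_hid HE) by bd.
      apply vcs_sqH. bd. }
    transitivity ((P ∥ b) ⫽ (sqV (vert (e A)) ∥ vH s f)).
    { rewrite EQ, sqV_hcs, hcs_hid by bd. reflexivity. }
    rewrite (interchange HE), EP, I4 by bd.
    rewrite sqH_vcs by bd. f_equal. f_equal. bd.
Qed.

(** After pasting with [eps], the axioms on [δ] become [vH_fc], [vH_fu] and [vH_nat] of the vertical
    transformation; those on 1v-cells come down to functoriality of [F] and [G]. *)
Lemma is_htr_of_lift : vtr_invertible s -> is_htr F G h.
Proof.
  intros Inv. split.
  - intros A. rewrite (lift_arr L). bd.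
  - intros u. rewrite !(lift_arr L). apply (lift_V_bd L).
  - intros A. pose proof (lift_V_bd L (vid A)). pose proof (lift_V L (vid A)) as EV.
    rewrite vsrc_vid, vtgt_vid in *. hyps. rewrite (lift_arr L).
    apply (cancel_eps (e := e A)); try bd.
    rewrite EV, (fV_vid HG), <- (sqH_hid HE), vcs_sqH, sqH_vcs by bd. reflexivity.
  - intros u v uv. pose proof (lift_V_bd L (vcomp u v)). pose proof (lift_V L (vcomp u v)) as EV.
    pose proof (lift_V_bd L u). pose proof (lift_V L u) as EU.
    pose proof (lift_V_bd L v). pose proof (lift_V L v) as EW.
    rewrite vsrc_vcomp, vtgt_vcomp, (fV_vcomp HF), (fV_vcomp HG) in * by bd. rewrite uv in *. hyps.
    apply (cancel_eps (e := e (vtgt v))); try bd.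
    rewrite EV, (vcs_assoc HE), EW, <- (vcs_assoc HE), EU, (vcs_assoc HE), (sqV_vcomp HE) by bd.
    reflexivity.
  - intros f. pose proof (lift_δ_bd L f). hyps. rewrite !(lift_arr L). bd.
  - apply lift_δ_invertible, Inv.
  - intros f g fg.
    pose proof (lift_δ_bd L f). pose proof (lift_H L f). pose proof (lift_δ L f) as Ef.
    pose proof (lift_δ_bd L g). pose proof (lift_H L g). pose proof (lift_δ L g) as Eg.
    pose proof (lift_δ_bd L (f ⋅ g)). pose proof (lift_H L (f ⋅ g)). pose proof (lift_δ L (f ⋅ g)) as Eh.
    rewrite hsrc_hcomp, htgt_hcomp in * by bd. rewrite !(lift_arr L).
    pose proof (vH_fc N fg) as Nfg.
    remember (hsrc f) as A eqn:EA in *. remember (htgt g) as C eqn:EC in *.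
    remember (hsrc g) as B eqn:EB in *. rewrite fg in *.
    symmetry in EA, EB, EC. hyps.
    apply (@cancel_eps_hcs _ _ _ _ (e A) (fH G (f ⋅ g))); try bd.
    rewrite !(vcs_assoc HE), Eh by bd.
    rewrite (@interchange _ HE (fc F f g)), <- Nfg, sqH_vcs by bd.
    transitivity ((sqH (fH F f) ∥ hδ h g) ⫽ (((hδ h f ∥ sqH (fH G g)) ⫽ ((eps (e A) ∥ sqH (fH G f)) ∥ sqH (fH G g))) ⫽ fc G f g)).
    + rewrite (@interchange _ HE (hδ h f)), Ef, vcs_sqH, (hcs_assoc HE), <- (vcs_assoc HE) by bd.
      rewrite (@interchange _ HE (sqH (fH F f))), Eg, sqH_vcs, <- (hcs_assoc HE) by bd.
      transitivity (((vH s f ∥ vH s g) ∥ eps (e C)) ⫽ (fc G f g ∥ sqH (hid (fO G C)))).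
      { now rewrite (interchange HE), vcs_sqH by bd. }
      now rewrite hcs_hid by bd.
    + rewrite (vcs_assoc HE) by bd. do 2 f_equal.
      rewrite (interchange HE), sqH_vcs, vcs_sqH by bd.
      rewrite (hcs_assoc HE), <- (sqH_hcomp HE) by bd.
      transitivity ((eps (e A) ∥ sqH (fH G f ⋅ fH G g)) ⫽ (sqH (hid (fO G A)) ∥ fc G f g)).
      { now rewrite hid_hcs by bd. }
      now rewrite (interchange HE), vcs_sqH, sqH_vcs by bd.
  - intros A.
    pose proof (lift_δ_bd L (hid A)). pose proof (lift_H L (hid A)). pose proof (lift_δ L (hid A)) as Ef.
    rewrite hsrc_hid, htgt_hid in *. hyps. rewrite !(lift_arr L).
    pose proof (vH_fu N A) as Nu. rewrite <- (lift_vert L) in Nu.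
    apply (@cancel_eps_hcs _ _ _ _ (e A) (fH G (hid A))); try bd.
    rewrite (vcs_assoc HE), Ef, (interchange HE), <- Nu, sqH_vcs by bd.
    transitivity ((sqV (vert (e A)) ∥ eps (e A)) ⫽ (fu G A ∥ sqH (hid (fO G A)))).
    { now rewrite (interchange HE), vcs_sqH by bd. }
    rewrite sqV_hcs, hcs_hid, (interchange HE), sqH_vcs, vcs_sqH by bd.
    (* ε ends and the unitor of [G] begins at the identity of G(A), so placing them side by side or
       stacking them gives the same square. *)
    symmetry. apply (hcs_eq_vcs (A := fO G A)); bd.
  - intros a.
    pose proof (lift_δ_bd L (top a)). pose proof (lift_H L (top a)). pose proof (lift_δ L (top a)) as Et.
    pose proof (lift_δ_bd L (bot a)). pose proof (lift_H L (bot a)). pose proof (lift_δ L (bot a)) as Eb.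
    pose proof (lift_V_bd L (lft a)). pose proof (lift_V L (lft a)) as El.
    pose proof (lift_V_bd L (rgt a)). pose proof (lift_V L (rgt a)) as Er.
    pose proof (vH_nat N a) as Na.
    rewrite (sq_nw HD), (sq_ne HD) in *. rewrite (sq_sw HD), (sq_se HD) in *. hyps.
    apply (@cancel_eps_hcs _ _ _ _ (e (vtgt (lft a))) (fH G (bot a))); try bd.
    rewrite !(vcs_assoc HE), Eb by bd.
    rewrite (interchange HE), Na, Er by bd.
    rewrite (@interchange _ HE (hV h (lft a))), El, vcs_sqH by bd.
    transitivity (hδ h (top a) ⫽ ((eps (e (vsrc (lft a))) ∥ sqH (fH G (top a))) ⫽ (sqV (fV G (lft a)) ∥ fS G a))).
    + rewrite <- (vcs_assoc HE), Et, sqV_hcs by bd.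
      transitivity ((vH s (top a) ∥ eps (e (vsrc (rgt a)))) ⫽ (fS G a ∥ sqV (fV G (rgt a)))).
      { now rewrite (interchange HE) by bd. }
      now rewrite hcs_sqV by bd.
    + now rewrite (interchange HE), sqH_vcs by bd.
Qed.

(** Both composites are companions of identity 1v-cells, hence comparable with [one_cp]; these
    comparisons are the invertible 2-cells of the equivalence. *)
Lemma hequiv_arr {A B : Ob E} (c : Cp A B) (c' : Cp B A) :
  vcomp (vert c) (vert c') = vid A -> vcomp (vert c') (vert c) = vid B -> hequiv (arr c).
Proof.
  intros E1 E2.
  assert (C1 := @canon_comparison _ _ _ _ (star c c') (one_cp A) E1).
  assert (C2 := @canon_comparison _ _ _ _ (star c' c) (one_cp B) E2).
  exists (arr c'). split; [bd|]. split.
  - eexists; split; [|exact (canon_vinvertible C1)]. destruct C1; simpl in *; hyps. bd.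
  - eexists; split; [|exact (canon_vinvertible C2)]. destruct C2; simpl in *; hyps. bd.
Qed.

(** [vtr_invertible] speaks only of squares; the inverse 1v-cell is the left side of the inverse of
    the square at [hid A]. *)
Lemma vtr_invertible_vO : vtr_invertible s -> forall A, exists v,
  isV v (fO G A) (fO F A) /\ vcomp (vO s A) v = vid (fO F A) /\ vcomp v (vO s A) = vid (fO G A).
Proof.
  intros Inv A. destruct (Inv (hid A)) as [b (I1 & I2 & I3 & I4)].
  pose proof (vH_bd N (hid A)). rewrite hsrc_hid, htgt_hid in *. hyps.
  assert (top b = fH G (hid A)) by congruence.
  assert (bot b = fH F (hid A)) by congruence.
  clear I1 I2.
  exists (lft b). split; [|split].
  - split; [rewrite <- (sq_nw HE)|rewrite <- (sq_sw HE)]; bd.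
  - transitivity (lft (vH s (hid A) ⫽ b)); [bd|rewrite I3; bd].
  - transitivity (lft (b ⫽ vH s (hid A))); [bd|rewrite I4; bd].
Qed.

End HorizontalEquivalences.

Section CompanionLifts.
Context {D E : dbl} {HD : is_dbl D} {HE : is_dbl E}.
Context {F G : pdf D E} {HF : is_pdf F} {HG : is_pdf G}.
Context {s : vtr D E} (N : is_vtr F G s) {c : companions D E} (Hc : is_companions s c).

Definition lift_cp (A : Ob D) : Cp (fO F A) (fO G A) := MkCp (vO_bd N A) (Hc A).

(** The η at the left of each defining formula meets the ε pasted below, and η/ε is an identity
    square. For α^u, naturality of [s] in 1v-cells does the rest. *)
Lemma is_lift_companion_lift : is_lift s (companion_lift F G s c) lift_cp.
Proof.
  assert (Eη : cη c = fun A => eta (lift_cp A)) by reflexivity.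
  assert (Eε : cε c = fun A => eps (lift_cp A)) by reflexivity.
  assert (Ev : forall A, vO s A = vert (lift_cp A)) by reflexivity.
  pose proof (vO_nat N) as Nv. pose proof (vH_bd N) as Hs. setoid_rewrite Ev in Nv. setoid_rewrite Ev in Hs.
  split; cbn [companion_lift hO hV hδ]; try reflexivity.
  - exact Hs.
  - intros f. specialize (Hs f). hyps. rewrite Eη, Eε. bd.
  - intros u. rewrite Eη, Eε. bd.
  - intros f. specialize (Hs f). hyps. rewrite Eη, Eε.
    rewrite (hcs_assoc HE), (interchange HE), eta_vcs_eps by bd.
    rewrite vcs_sqH, sqV_hcs by bd. reflexivity.
  - intros u. rewrite Eη, Eε.
    transitivity (((sqV (fV F u) ⫽ eta (lift_cp (vtgt u))) ∥ (eps (lift_cp (vsrc u)) ⫽ sqV (fV G u)))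
      ⫽ (eps (lift_cp (vtgt u)) ∥ sqH (hid (fO G (vtgt u))))).
    { now rewrite hcs_hid by bd. }
    rewrite (interchange HE), (vcs_assoc HE), eta_vcs_eps, <- (sqV_vcomp HE), Nv by bd.
    rewrite vcs_sqH, sqV_hcs by bd. reflexivity.
Qed.

Lemma companion_lift_equivalence :
  vtr_invertible s -> inverse_liftable s ->
  is_horizontal_equivalence F G (companion_lift F G s c).
Proof.
  intros Inv IL. split.
  { exact (is_htr_of_lift N is_lift_companion_lift Inv). }
  intros A. destruct (vtr_invertible_vO N Inv A) as (v & Hv & E1 & E2).
  destruct (vO_bd N A) as [S T].
  destruct (IL A v) as (k & ε & η & Hk); try (rewrite ?S, ?T; assumption).
  exact (hequiv_arr (c := lift_cp A) (c' := MkCp Hv Hk) E1 E2).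
Qed.

End CompanionLifts.

Lemma liftable_companions {D E : dbl} (t : vtr D E) :
  liftable t -> exists c, is_companions t c.
Proof.
  intros H.
  destruct (@functional_choice (Ob D) (Hc E * Sq E * Sq E)
    (fun A x => is_companion (vO t A) (fst (fst x)) (snd (fst x)) (snd x))) as [f Hf].
  { intros A. destruct (H A) as (c & ε & η & Hc). now exists (c, ε, η). }
  now exists (Companions (fun A => fst (fst (f A))) (fun A => snd (fst (f A))) (fun A => snd (f A))).
Qed.

(** The two sides of an axiom bring their own bracketings of source and target; [assoc] settles the
    resulting equations. *)
Lemma canon_coherence {D : dbl} {HD : is_dbl D} {A B : Ob D} (e e' f f' : Cp A B) (θ φ : Sq D) :
  canon e e' θ -> canon f f' φ -> e = f -> e' = f' -> θ = φ.
Proof. intros H K <- <-. exact (canon_unique H K). Qed.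

Ltac assoc := rewrite ?star_assoc; reflexivity.

(** * Coherence *)

(** Nested images paste the unitors exactly as the composite functor does. Images under [assocL T]
    and [assocR T] can thus be rewritten as iterated tensor products. *)
Lemma map_fcomp {C D E : dbl} {HC : is_dbl C} {HD : is_dbl D} {HE : is_dbl E}
    (G : pdf D E) (F : pdf C D) {HG : is_pdf G} {HF : is_pdf F} {A B : Ob C} (e : Cp A B) :
  map_cp (fcomp G F) e = map_cp G (map_cp F e).
Proof.
  apply Cp_eq; simpl. rewrite (fS_vcs HG), (vcs_assoc HE) by bd. reflexivity.
Qed.

Lemma map_fprod {C D C' D' : dbl} {HC : is_dbl C} {HD : is_dbl D} {HC' : is_dbl C'} {HD' : is_dbl D'}
    (F : pdf C D) (G : pdf C' D') {HF : is_pdf F} {HG : is_pdf G}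
    {A B : Ob C} {A' B' : Ob C'} (e : Cp A B) (e' : Cp A' B') :
  map_cp (fprod F G) (pair_cp e e') = pair_cp (map_cp F e) (map_cp G e').
Proof. now apply Cp_eq. Qed.

Lemma map_fid {D : dbl} {HD : is_dbl D} {A B : Ob D} (e : Cp A B) : map_cp (fid D) e = e.
Proof. apply Cp_eq; simpl. apply vcs_sqH. bd. Qed.

Lemma map_fassoc {C D E : dbl} {HC : is_dbl C} {HD : is_dbl D} {HE : is_dbl E}
    {A B : Ob C} {A' B' : Ob D} {A'' B'' : Ob E} (x : Cp A B) (y : Cp A' B') (z : Cp A'' B'') :
  map_cp (fassoc C D E) (pair_cp (pair_cp x y) z) = pair_cp x (pair_cp y z).
Proof. apply Cp_eq; simpl. rewrite !vcs_sqH by bd. reflexivity. Qed.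

(** Functors enter a modification only through their values on 1h-cells. This later replaces
    composites with identity functors by [T] itself. *)
Lemma is_inv_modification_maps {D E : dbl} (F F' G G' : pdf D E) s t m :
  is_inv_modification F G s t m ->
  (forall f, fH F f = fH F' f) -> (forall f, fH G f = fH G' f) ->
  is_inv_modification F' G' s t m.
Proof.
  intros M EF EG. split; try apply M.
  intros f. rewrite <- EF, <- EG. apply M.
Qed.

Section Coherence.
Context {D : dbl} {HD : is_dbl D} {T : pdf (D × D) D} {HT : is_pdf T} {I : pdf dunit D} {HI : is_pdf I}.
Context {α : vtr (D × D × D) D} {λ ρ : vtr D D}.
Context (Nα : is_vtr (assocL T) (assocR T) α).
Context (Nλ : is_vtr (unitL T I) (fid D) λ).
Context (Nρ : is_vtr (unitR T I) (fid D) ρ).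
Context {cα : companions (D × D × D) D} {cλ cρ : companions D D}.
Context (Cα : is_companions α cα).
Context (Cλ : is_companions λ cλ).
Context (Cρ : is_companions ρ cρ).

Let α' := companion_lift (assocL T) (assocR T) α cα.
Let λ' := companion_lift (unitL T I) (fid D) λ cλ.
Let ρ' := companion_lift (unitR T I) (fid D) ρ cρ.
Let one : Ob D := fO I tt.
Notation "A ⊗ B" := (fO T (A, B)) (at level 38, left associativity).

Definition a_cp (A B C : Ob D) : Cp (A ⊗ B ⊗ C) (A ⊗ (B ⊗ C)) := lift_cp Nα Cα (A, B, C).
Definition l_cp (A : Ob D) : Cp (one ⊗ A) A := lift_cp Nλ Cλ A.
Definition r_cp (A : Ob D) : Cp (A ⊗ one) A := lift_cp Nρ Cρ A.
Definition tensor_cp {A B A' B' : Ob D} (x : Cp A B) (y : Cp A' B') : Cp (A ⊗ A') (B ⊗ B') :=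
  map_cp T (pair_cp x y).
Notation "x ⊠ y" := (tensor_cp x y) (at level 38, left associativity).

Lemma canon_tensor {A B A' B' : Ob D} (x x' : Cp A B) (y y' : Cp A' B') θ φ :
  canon x x' θ -> canon y y' φ -> canon (x ⊠ y) (x' ⊠ y') (fS T (θ, φ)).
Proof. intros H K. exact (canon_map (F:=T) (canon_pair H K)). Qed.

Lemma canon_tensor_fc {A B C A' B' C' : Ob D} (x : Cp A B) (y : Cp B C) (x' : Cp A' B') (y' : Cp B' C') :
  canon (star (x ⊠ x') (y ⊠ y')) (star x y ⊠ star x' y') (fc T (arr x, arr x') (arr y, arr y')).
Proof. exact (canon_fc (F:=T) (pair_cp x x') (pair_cp y y')). Qed.

Lemma canon_tensor_fci {A B C A' B' C' : Ob D} (x : Cp A B) (y : Cp B C) (x' : Cp A' B') (y' : Cp B' C') :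
  canon (star x y ⊠ star x' y') (star (x ⊠ x') (y ⊠ y')) (fci T (arr x, arr x') (arr y, arr y')).
Proof. exact (canon_fci (F:=T) (pair_cp x x') (pair_cp y y')). Qed.

Lemma canon_tensor_fu (A B : Ob D) : canon (one_cp (A ⊗ B)) (one_cp A ⊠ one_cp B) (fu T (A, B)).
Proof. exact (canon_fu (F:=T) (A, B)). Qed.

Lemma canon_tensor_fui (A B : Ob D) : canon (one_cp A ⊠ one_cp B) (one_cp (A ⊗ B)) (fui T (A, B)).
Proof. exact (canon_fui (F:=T) (A, B)). Qed.

Lemma map_assocL {A B A' B' A'' B'' : Ob D} (x : Cp A B) (y : Cp A' B') (z : Cp A'' B'') :
  map_cp (assocL T) (pair_cp (pair_cp x y) z) = (x ⊠ y) ⊠ z.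
Proof.
  unfold assocL. rewrite map_fcomp, map_fprod, map_fid. reflexivity.
Qed.

Lemma map_assocR {A B A' B' A'' B'' : Ob D} (x : Cp A B) (y : Cp A' B') (z : Cp A'' B'') :
  map_cp (assocR T) (pair_cp (pair_cp x y) z) = x ⊠ (y ⊠ z).
Proof.
  unfold assocR. rewrite !map_fcomp, map_fassoc.
  change (map_cp T (map_cp (fprod (fid D) T) (pair_cp x (pair_cp y z))) = x ⊠ (y ⊠ z)).
  rewrite map_fprod, map_fid. reflexivity.
Qed.

Lemma canon_δ {A B A' B' A'' B'' : Ob D} (x : Cp A B) (y : Cp A' B') (z : Cp A'' B'') :
  canon (star (x ⊠ y ⊠ z) (a_cp B B' B'')) (star (a_cp A A' A'') (x ⊠ (y ⊠ z)))
    (hδ α' (arr x, arr y, arr z)).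
Proof.
  rewrite <- map_assocL, <- map_assocR.
  exact (canon_lift_δ (is_lift_companion_lift Nα Cα) Nα (pair_cp (pair_cp x y) z)).
Qed.

(* [- ⊗ E] and [A ⊗ -] applied to a comparison of composites, in the form in
   which [R21], [L21], [R32], [L32] of [TA1]-[TA3] paste it *)
Lemma canon_R21 {A B C E : Ob D} (x : Cp A B) (y : Cp B C) (z : Cp A C) θ :
  canon (star x y) z θ ->
  canon (star (x ⊠ one_cp E) (y ⊠ one_cp E)) (z ⊠ one_cp E)
    (fc T (arr x, hid E) (arr y, hid E) ⫽ fS T (θ, sqH (hid E))).
Proof.
  intros H.
  refine (canon_vcs (canon_tensor_fc x y (one_cp E) (one_cp E)) (canon_tensor H (canon_sqH (one_cp E))) _).
  now rewrite star_one_l.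
Qed.

Lemma canon_L21 {A B C E : Ob D} (x : Cp A B) (y : Cp B C) (z : Cp A C) θ :
  canon (star x y) z θ ->
  canon (star (one_cp E ⊠ x) (one_cp E ⊠ y)) (one_cp E ⊠ z)
    (fc T (hid E, arr x) (hid E, arr y) ⫽ fS T (sqH (hid E), θ)).
Proof.
  intros H.
  refine (canon_vcs (canon_tensor_fc (one_cp E) (one_cp E) x y) (canon_tensor (canon_sqH (one_cp E)) H) _).
  now rewrite star_one_l.
Qed.

Lemma canon_R32 {A B C B' F E : Ob D} (x : Cp A B) (y : Cp B C) (z : Cp C F) (x' : Cp A B') (y' : Cp B' F) θ :
  canon (star x (star y z)) (star x' y') θ ->
  canon (star (x ⊠ one_cp E) (star (y ⊠ one_cp E) (z ⊠ one_cp E))) (star (x' ⊠ one_cp E) (y' ⊠ one_cp E))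
    ((fc T (arr x, hid E) (arr y, hid E) ∥ sqH (fH T (arr z, hid E)))
     ⫽ (fc T (arr x ⋅ arr y, hid E) (arr z, hid E) ⫽ fS T (θ, sqH (hid E)))
     ⫽ fci T (arr x', hid E) (arr y', hid E)).
Proof.
  (* [pent3] is bracketed to the right, whereas [R32] composes [x] with [y] first. *)
  intros H. rewrite <- (star_assoc x y z) in H. rewrite <- star_assoc.
  refine (canon_vcs (canon_vcs (canon_hcs (canon_tensor_fc x y (one_cp E) (one_cp E))
    (canon_sqH (z ⊠ one_cp E))) (canon_R21 H) _) (canon_tensor_fci x' y' (one_cp E) (one_cp E)) _);
    now rewrite star_one_l.
Qed.

Lemma canon_L32 {A B C B' F E : Ob D} (x : Cp A B) (y : Cp B C) (z : Cp C F) (x' : Cp A B') (y' : Cp B' F) θ :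
  canon (star x (star y z)) (star x' y') θ ->
  canon (star (one_cp E ⊠ x) (star (one_cp E ⊠ y) (one_cp E ⊠ z))) (star (one_cp E ⊠ x') (one_cp E ⊠ y'))
    ((fc T (hid E, arr x) (hid E, arr y) ∥ sqH (fH T (hid E, arr z)))
     ⫽ (fc T (hid E, arr x ⋅ arr y) (hid E, arr z) ⫽ fS T (sqH (hid E), θ))
     ⫽ fci T (hid E, arr x') (hid E, arr y')).
Proof.
  intros H. rewrite <- (star_assoc x y z) in H. rewrite <- star_assoc.
  refine (canon_vcs (canon_vcs (canon_hcs (canon_tensor_fc (one_cp E) (one_cp E) x y)
    (canon_sqH (one_cp E ⊠ z))) (canon_L21 H) _) (canon_tensor_fci (one_cp E) (one_cp E) x' y') _);
    now rewrite star_one_l.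
Qed.

(** * The three tricategory axioms *)

Section TA.
Context (p : Ob (D × D × D × D) -> Sq D) (m l r : Ob (D × D) -> Sq D).
Context (Hp : forall A B C E,
  canon (star (a_cp A B C ⊠ one_cp E) (star (a_cp A (B ⊗ C) E) (one_cp A ⊠ a_cp B C E)))
    (star (a_cp (A ⊗ B) C E) (a_cp A B (C ⊗ E))) (p (A, B, C, E))).
Context (Hm : forall A B,
  canon (star (a_cp A one B) (one_cp A ⊠ l_cp B)) (r_cp A ⊠ one_cp B) (m (A, B))).
Context (Hl : forall A B,
  canon (star (a_cp one A B) (l_cp (A ⊗ B))) (l_cp A ⊠ one_cp B) (l (A, B))).
Context (Hr : forall A B,
  canon (star (a_cp A B one) (one_cp A ⊠ r_cp B)) (r_cp (A ⊗ B)) (r (A, B))).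

Notation id x := (canon_sqH x).

(** The proof term copies the pasting: a [canon_vcs] for each passage to the next row, a [canon_hcs]
    for each juxtaposition. The holes ask that consecutive rows, and finally the two sides, have
    equal ends; these differ only by bracketing. *)
Lemma TA1_companion_lift : TA1 T α' p.
Proof.
  unfold TA1. cbv zeta beta. intros A B C H E d Hd.
  pose proof (canon_vinverse (canon_δ (one_cp A) (one_cp B) (a_cp C H E)) Hd) as Kd.
  pose (x0 := one_cp A ⊠ (one_cp B ⊠ a_cp C H E)).
  pose (x1 := a_cp (A ⊗ B) C H ⊠ one_cp E).
  pose (x2 := a_cp (A ⊗ B) (C ⊗ H) E).
  pose (x3 := one_cp A ⊠ a_cp B (C ⊗ H) E).
  pose (x4 := a_cp A B (C ⊗ (H ⊗ E))).
  pose (y1 := a_cp A B C ⊠ one_cp H ⊠ one_cp E).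
  pose (y2 := a_cp A (B ⊗ C) H ⊠ one_cp E).
  pose (y3 := a_cp A (B ⊗ C) (H ⊗ E)).
  pose (y4 := one_cp A ⊠ a_cp B C (H ⊗ E)).
  pose (y5 := a_cp (A ⊗ B ⊗ C) H E).
  refine (canon_coherence
    (canon_vcs (canon_vcs (canon_vcs (canon_vcs
      (canon_hcs (canon_hcs (canon_hcs
         (canon_R32 (Hp A B C H)) (id (a_cp A (B ⊗ (C ⊗ H)) E))) (id x3)) (id x0))
      (canon_hcs (canon_hcs (id x1) (Hp A B (C ⊗ H) E)) (id x0)) _)
      (canon_hcs (canon_hcs (id x1) (id x2)) Kd) _)
      (canon_hcs (canon_hcs (canon_hcs (id x1) (id x2))
         (canon_tensor (canon_tensor_fui A B) (id (a_cp C H E)))) (id x4)) _)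
      (canon_hcs (Hp (A ⊗ B) C H E) (id x4)) _)
    (canon_vcs (canon_vcs (canon_vcs (canon_vcs (canon_vcs
      (canon_hcs (canon_hcs (canon_hcs (canon_hcs (id y1) (id y2))
         (canon_δ (one_cp A) (a_cp B C H) (one_cp E))) (id x3)) (id x0))
      (canon_hcs (canon_hcs (canon_hcs (id y1) (id y2)) (id (a_cp A (B ⊗ C ⊗ H) E)))
         (canon_L32 (Hp B C H E))) _)
      (canon_hcs (canon_hcs (id y1) (Hp A (B ⊗ C) H E)) (id y4)) _)
      (canon_hcs (canon_hcs (canon_δ (a_cp A B C) (one_cp H) (one_cp E)) (id y3)) (id y4)) _)
      (canon_hcs (canon_hcs (canon_hcs (id y5)
         (canon_tensor (id (a_cp A B C)) (canon_tensor_fui H E))) (id y3)) (id y4)) _)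
      (canon_hcs (id y5) (Hp A B C (H ⊗ E))) _) _ _);
    unfold x0, x1, x2, x3, x4, y1, y2, y3, y4, y5; assoc.
Qed.

Lemma TA2_companion_lift : TA2 T I α' λ' ρ' p m l.
Proof.
  unfold TA2. cbv zeta beta. intros A B C d e Hd He.
  pose proof (canon_vinverse (canon_δ (one_cp A) (l_cp B) (one_cp C)) Hd) as Kd.
  pose proof (canon_vinverse (canon_δ (r_cp A) (one_cp B) (one_cp C)) He) as Ke.
  pose (x1 := a_cp A one B ⊠ one_cp C).
  pose (x2 := a_cp (A ⊗ one) B C).
  refine (canon_coherence
    (canon_vcs (canon_vcs
      (canon_hcs (canon_hcs (id x1) (id (a_cp A (one ⊗ B) C))) (canon_L21 (Hl B C)))
      (canon_hcs (id x1) Kd) _)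
      (canon_hcs (canon_R21 (Hm A B)) (id (a_cp A B C))) _)
    (canon_vcs (canon_vcs (canon_vcs
      (canon_hcs (Hp A one B C) (id (one_cp A ⊠ l_cp (B ⊗ C))))
      (canon_hcs (id x2) (Hm A (B ⊗ C))) _)
      (canon_hcs (id x2) (canon_tensor (id (r_cp A)) (canon_tensor_fu B C))) _)
      Ke _) _ _);
    unfold x1, x2; assoc.
Qed.

Lemma TA3_companion_lift : TA3 T I α' λ' ρ' p m r.
Proof.
  unfold TA3. cbv zeta beta. intros A B C d e Hd He.
  pose proof (canon_vinverse (canon_δ (one_cp A) (r_cp B) (one_cp C)) Hd) as Kd.
  pose proof (canon_vinverse (canon_δ (one_cp A) (one_cp B) (l_cp C)) He) as Ke.
  pose (x1 := a_cp A B one ⊠ one_cp C).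
  pose (x2 := a_cp (A ⊗ B) one C).
  refine (canon_coherence
    (canon_vcs (canon_vcs
      (canon_hcs (canon_hcs (id x1) (id (a_cp A (B ⊗ one) C))) (canon_L21 (Hm B C)))
      (canon_hcs (id x1) Kd) _)
      (canon_hcs (canon_R21 (Hr A B)) (id (a_cp A B C))) _)
    (canon_vcs (canon_vcs (canon_vcs
      (canon_hcs (Hp A B one C) (id (one_cp A ⊠ (one_cp B ⊠ l_cp C))))
      (canon_hcs (id x2) Ke) _)
      (canon_hcs (canon_hcs (id x2) (canon_tensor (canon_tensor_fui A B) (id (l_cp C))))
        (id (a_cp A B C))) _)
      (canon_hcs (Hm (A ⊗ B) C) (id (a_cp A B C))) _) _ _);
    unfold x1, x2; assoc.
Qed.

End TA.

(** * The modifications p, m, l and r *)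

Let Lα := is_lift_companion_lift Nα Cα.
Let Lλ := is_lift_companion_lift Nλ Cλ.
Let Lρ := is_lift_companion_lift Nρ Cρ.
Let L1 : is_lift (F := fid D) (G := fid D) (vtr_id (fid D)) (htr_id (fid D)) (fun A => one_cp A) := is_lift_id.

(* [is_lift] only involves the underlying maps of the functors, which makes
   lifts along functors with different compositors composable. *)
Ltac relift L F' G' :=
  match type of L with
  | is_lift ?s ?h ?e =>
    let H := fresh in
    assert (H : is_lift (F := F') (G := G') s h e) by (destruct L; split; assumption);
    clear L; rename H into L
  end.

Lemma pentagon_modification :
  vtr_eq
    (vtr_comp (vtr_post T (vtr_prod α (vtr_id (fid D))))
      (vtr_comp (vtr_pre (K_A_BC_D T) α)
        (vtr_pre (K_A'BCD D) (vtr_post T (vtr_prod (vtr_id (fid D)) α)))))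
    (vtr_comp (vtr_pre (K_AB_C_D T) α) (vtr_pre (K_A_B_CD T) α)) ->
  exists p, is_inv_modification (quadL T) (quadR T) (pent3 T α') (pent2 T α') p /\
    forall A B C E,
      canon (star (a_cp A B C ⊠ one_cp E) (star (a_cp A (B ⊗ C) E) (one_cp A ⊠ a_cp B C E)))
        (star (a_cp (A ⊗ B) C E) (a_cp A B (C ⊗ E))) (p (A, B, C, E)).
Proof.
  intros Pent.
  pose proof (is_lift_post (K := T) (is_lift_prod Lα L1)) as L2.
  pose proof (is_lift_pre (K := K_A_BC_D T) Lα) as L3.
  pose proof (is_lift_pre (K := K_A'BCD D) (is_lift_post (K := T) (is_lift_prod L1 Lα))) as L4.
  pose proof (is_lift_pre (K := K_AB_C_D T) Lα) as L5.
  pose proof (is_lift_pre (K := K_A_B_CD T) Lα) as L6.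
  (* The target of one lift has to be literally the source of the next: (A⊗(B⊗C))⊗D, for instance,
     arises both from α⊗D and as the source of α at (A, B⊗C, D). *)
  relift L2 (quadL T) (fcomp (assocL T) (K_A_BC_D T)).
  relift L4 (fcomp (assocR T) (K_A_BC_D T)) (quadR T).
  relift L5 (quadL T) (fcomp (assocL T) (K_A_B_CD T)).
  relift L6 (fcomp (assocL T) (K_A_B_CD T)) (quadR T).
  pose proof (is_lift_comp L2 (is_lift_comp L3 L4)) as L234.
  pose proof (is_lift_comp L5 L6) as L56.
  destruct (comparison_modification L234 L56 Pent) as (p & Mp & Cp).
  exists p. split; [exact Mp|]. intros A B C E. exact (Cp (A, B, C, E)).
Qed.

(* For [X] a variable of product type, [(fst X, snd X)] is not convertible to
   [X], so the transformations have to be compared on explicit pairs. *)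
Ltac relift_pairs L F' G' s' h' :=
  match type of L with
  | is_lift _ _ ?e =>
    let H := fresh in
    assert (H : is_lift (F := F') (G := G') s' h' e)
      by (destruct L; split; intros [? ?];
          match goal with K : forall _, _ |- _ => exact (K (_, _)) end);
    clear L; rename H into L
  end.

(** [T] with its argument split into components, the form in which the lifts of A⊗λ_B, A⊗ρ_B, λ_A⊗B
    and ρ_A⊗B end. *)
Let TT : pdf (D × D) D := fcomp T (fprod (fid D) (fid D)).

Lemma middle_modification :
  vtr_eq (vtr_comp (vtr_pre (K_A_I_B I) α) (vtr_post T (vtr_prod (vtr_id (fid D)) λ)))
    (vtr_post T (vtr_prod ρ (vtr_id (fid D)))) ->
  exists m,
    is_inv_modification (pairRI T I) T (htr_comp (htr_pre (K_A_I_B I) α') (A_λB T I λ'))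
      (ρA_B T I ρ') m /\
    forall A B, canon (star (a_cp A one B) (one_cp A ⊠ l_cp B)) (r_cp A ⊠ one_cp B) (m (A, B)).
Proof.
  intros Mid.
  pose proof (is_lift_pre (K := K_A_I_B I) Lα) as L2.
  pose proof (is_lift_post (K := T) (is_lift_prod L1 Lλ)) as L3.
  pose proof (is_lift_post (K := T) (is_lift_prod Lρ L1)) as L4.
  relift L2 (pairRI T I) (fcomp (assocR T) (K_A_I_B I)).
  relift L3 (fcomp (assocR T) (K_A_I_B I)) TT.
  pose proof (is_lift_comp L2 L3) as L23.
  destruct (comparison_modification L23 L4 Mid) as (m & Mm & Cm).
  exists m. split.
  - apply (is_inv_modification_maps Mm); intros []; reflexivity.
  - intros A B. exact (Cm (A, B)).
Qed.

Lemma left_modification :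
  vtr_eq (vtr_comp (vtr_pre (K_I_A_B I) α) (vtr_pre T λ))
    (vtr_post T (vtr_prod λ (vtr_id (fid D)))) ->
  exists l,
    is_inv_modification (pairLI T I) T (htr_comp (htr_pre (K_I_A_B I) α') (htr_pre T λ'))
      (λA_B T I λ') l /\
    forall A B, canon (star (a_cp one A B) (l_cp (A ⊗ B))) (l_cp A ⊠ one_cp B) (l (A, B)).
Proof.
  intros Lft.
  pose proof (is_lift_pre (K := K_I_A_B I) Lα) as L2.
  pose proof (is_lift_pre (K := TT) Lλ) as L3.
  pose proof (is_lift_post (K := T) (is_lift_prod Lλ L1)) as L4.
  relift L2 (pairLI T I) (fcomp (assocR T) (K_I_A_B I)).
  relift_pairs L3 (fcomp (assocR T) (K_I_A_B I)) TT (vtr_pre T λ) (htr_pre T λ').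
  pose proof (is_lift_comp L2 L3) as L23.
  destruct (comparison_modification L23 L4 Lft) as (l & Ml & Cl).
  exists l. split.
  - apply (is_inv_modification_maps Ml); intros []; reflexivity.
  - intros A B. exact (Cl (A, B)).
Qed.

Lemma right_modification :
  vtr_eq (vtr_comp (vtr_pre (K_A_B_I I) α) (vtr_post T (vtr_prod (vtr_id (fid D)) ρ)))
    (vtr_pre T ρ) ->
  exists r,
    is_inv_modification (pairIR T I) T (htr_comp (htr_pre (K_A_B_I I) α') (A_ρB T I ρ'))
      (htr_pre T ρ') r /\
    forall A B, canon (star (a_cp A B one) (one_cp A ⊠ r_cp B)) (r_cp (A ⊗ B)) (r (A, B)).
Proof.
  intros Rgt.
  (* [K_A_B_I] passes its pair on unsplit, through [fid (D × D)]; precomposing with a product of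
     identities splits it into components. *)
  pose proof (is_lift_pre (K := fcomp (K_A_B_I I) (fprod (fid D) (fid D))) Lα) as L2.
  pose proof (is_lift_post (K := T) (is_lift_prod L1 Lρ)) as L3.
  pose proof (is_lift_pre (K := TT) Lρ) as L4.
  relift_pairs L2 (fcomp (unitR T I) TT) (fcomp (assocR T) (K_A_B_I I))
    (vtr_pre (K_A_B_I I) α) (htr_pre (K_A_B_I I) α').
  relift L3 (fcomp (assocR T) (K_A_B_I I)) TT.
  relift_pairs L4 (fcomp (unitR T I) TT) TT (vtr_pre T ρ) (htr_pre T ρ').
  pose proof (is_lift_comp L2 L3) as L23.
  destruct (comparison_modification L23 L4 Rgt) as (r & Mr & Cr).
  exists r. split.
  - apply (is_inv_modification_maps Mr); intros []; reflexivity.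
  - intros A B. exact (Cr (A, B)).
Qed.

End Coherence.

Theorem theorem10p10 (D : dbl) (T : pdf (D × D) D) (I : pdf dunit D)
    (α : vtr (D × D × D) D) (λ ρ : vtr D D) :
  is_monoidal_double T I α λ ρ ->
  liftable α -> liftable λ -> liftable ρ ->
  inverse_liftable α -> inverse_liftable λ -> inverse_liftable ρ ->
  (exists cα cλ cρ,
     is_companions α cα /\ is_companions λ cλ /\ is_companions ρ cρ) /\
  (forall (cα : companions (D × D × D) D) (cλ cρ : companions D D),
     is_companions α cα -> is_companions λ cλ -> is_companions ρ cρ ->
     exists p m l r,
       is_horizontally_monoidal T I
         (companion_lift (assocL T) (assocR T) α cα)
         (companion_lift (unitL T I) (fid D) λ cλ)
         (companion_lift (unitR T I) (fid D) ρ cρ)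
         p m l r).
Proof.
  intros [HD HT HI Nα Iα Nλ Iλ Nρ Iρ Pent Mid Lft Rgt] Sα Sλ Sρ Rα Rλ Rρ.
  split.
  { destruct (liftable_companions Sα) as [cα Cα].
    destruct (liftable_companions Sλ) as [cλ Cλ].
    destruct (liftable_companions Sρ) as [cρ Cρ].
    now exists cα, cλ, cρ. }
  intros cα cλ cρ Cα Cλ Cρ.
  destruct (pentagon_modification Nα Cα Pent) as (p & Mp & Hp).
  destruct (middle_modification Nα Nλ Nρ Cα Cλ Cρ Mid) as (m & Mm & Hm).
  destruct (left_modification Nα Nλ Cα Cλ Lft) as (l & Ml & Hl).
  destruct (right_modification Nα Nρ Cα Cρ Rgt) as (r & Mr & Hr).
  exists p, m, l, r. split; try assumption.
  - exact (companion_lift_equivalence Nα Cα Iα Rα).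
  - exact (companion_lift_equivalence Nλ Cλ Iλ Rλ).
  - exact (companion_lift_equivalence Nρ Cρ Iρ Rρ).
  - exact (TA1_companion_lift Hp).
  - exact (TA2_companion_lift Hp Hm Hl).
  - exact (TA3_companion_lift Hp Hm Hr).
Qed.
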